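(* Let $k\ge3$ be an integer and put $\varrho=\varrho_k=\frac{1}{k(3k+1)}$. There exist $f_0$ and $M$, depending only on $k$, with the following property. Let $f\ge f_0$, let $\mathcal H$ be an extremal $k$-angulation hypergraph on $n=(k-2)f+2$ vertices, let $x$ be its Perron vector normalized by $\sum_v x_v^k=1$, let $x_1\ge x_2\ge\cdots\ge x_n$ be its coordinates in nonincreasing order, and let $d_1$ be the number of faces containing the vertex carrying $x_1$. Then $$\bigl|\lambda(\mathcal H)^k-4f\bigr|\le Mf^{1-\varrho},\qquad \Bigl|x_1^{k}-\frac1k\Bigr|\le Mf^{-\varrho/2},\qquad x_2^{k}\le Mf^{-\varrho},\qquad d_1\ge f-Mf^{1-\varrho/(2k)} .$$
   Context: For an integer $k\ge3$, a $k$-angulation is a simple $2$-connected outerplane graph all of whose interior faces are bounded by cycles of length $k$. If $G$ has $n$ vertices and $f$ interior faces, then $n-2=f(k-2)$. ''Face'' means interior face. The face hypergraph $\mathcal H(G)$ is the $k$-uniform hypergraph on $V(G)$ whose edges are the vertex sets of the interior faces of $G$. A $k$-uniform hypergraph is a $k$-angulation hypergraph if it is the face hypergraph of some $k$-angulation; the faces of such a hypergraph are its edges. The spectral radius of a $k$-uniform hypergraph $\mathcal H$ on $n$ vertices is $$\lambda(\mathcal H)=\max\Bigl\{P_{\mathcal H}(x): x\in\mathbb R_{\ge0}^n,\ \sum_v x_v^k=1\Bigr\},\qquad P_{\mathcal H}(x)=k\sum_{e\in E(\mathcal H)}\prod_{v\in e}x_v .$$ When $\mathcal H$ is connected, the maximum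 is attained at a positive vector, unique up to scaling, called the Perron vector of $\mathcal H$. A $k$-angulation hypergraph on $n$ vertices is extremal if its spectral radius is maximum among all $k$-angulation hypergraphs on $n$ vertices. *)

(* Defs.v *)
From HB Require Import structures.
From mathcomp Require Import all_boot all_order all_algebra all_fingroup.
From mathcomp Require Import all_classical all_reals all_analysis.

Set Implicit Arguments.
Unset Strict Implicit.
Unset Printing Implicit Defensive.

Import Order.TTheory GRing.Theory Num.Theory.

Local Open Scope ring_scope.

(* A finite simple graph drawn on a closed oriented surface, given by its
   rotation system: [rot v] permutes the neighbours of [v] in one cycle, the
   cyclic order of the edges around [v].  Its values off the neighbours of [v]
   are irrelevant. *)
Record embedded_graph (V : finType) := EmbeddedGraph {
  adj : rel V;
  rot : V -> {perm V};
  adj_sym : symmetric adj;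
  adj_irrefl : irreflexive adj;
  rotP : forall u v w, adj u v -> (w \in porbit (rot u) v) = adj u w
}.

Section PlaneGraphs.
Variables (V : finType) (G : embedded_graph V).

Definition connected_off (X : {set V}) : Prop :=
  forall u w, u \notin X -> w \notin X ->
    connect [rel a b | [&& adj G a b, a \notin X & b \notin X]] u w.

Definition two_connected : Prop :=
  (2 < #|V|)%N /\ forall X : {set V}, (#|X| < 2)%N -> connected_off X.

Definition darts : {set V * V} := [set d | adj G d.1 d.2].

Definition edges : {set {set V}} := [set [set d.1; d.2] | d in darts].

(* The successor of the dart [u -> v] on the boundary walk of the face lying
   on a fixed side of it. *)
Definition face_next (d : V * V) : V * V := (d.2, rot G d.2 d.1).

(* A face is represented by the set of darts on its boundary walk. *)
Definition face_at (d : V * V) : {set V * V} :=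
  [set d' | fconnect face_next d d'].

Definition faces : {set {set V * V}} := [set face_at d | d in darts].

Definition face_verts (F : {set V * V}) : {set V} := [set d.1 | d in F].

(* For a connected graph, Euler's formula says that the surface obtained by
   gluing a disc to each boundary walk is the sphere. *)
Definition plane : Prop :=
  connected_off finset.set0 /\ (#|V| + #|faces| = #|edges| + 2)%N.

(* A plane graph is a graph on the sphere with a chosen outer face [O]. *)
Definition outerplane (O : {set V * V}) : Prop :=
  [/\ plane, O \in faces & face_verts O = [set: V]].

(* The boundary walk has [k] steps and no repeated vertex. *)
Definition bounded_by_cycle (k : nat) (F : {set V * V}) : Prop :=
  #|F| = k /\ #|face_verts F| = k.

Definition interior_faces (O : {set V * V}) : {set {set V * V}} := faces :\ O.

Definition k_angulation (k : nat) (O : {set V * V}) : Prop :=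
  [/\ two_connected, outerplane O &
      forall F, F \in interior_faces O -> bounded_by_cycle k F].

Definition face_hypergraph (O : {set V * V}) : {set {set V}} :=
  [set face_verts F | F in interior_faces O].

End PlaneGraphs.

Definition k_angulation_hypergraph (k : nat) (V : finType)
    (H : {set {set V}}) : Prop :=
  exists (G : embedded_graph V) (O : {set V * V}),
    k_angulation G k O /\ H = face_hypergraph G O.

Section Spectral.
Variables (R : realType) (k : nat) (V : finType).
Implicit Types (H : {set {set V}}) (x : V -> R).

Definition hpoly H x : R := k%:R * \sum_(e in H) \prod_(v in e) x v.

Definition feasible x : Prop :=
  (forall v, 0 <= x v) /\ \sum_v x v ^+ k = 1.

(* For k > 0 and V nonempty the feasible set is compact and nonempty, so the
   supremum is a maximum. *)
Definition spectral_radius H : R :=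
  sup [set hpoly H x | x in [set x | feasible x]]%classic.

Definition perron_vector H x : Prop :=
  [/\ forall v, 0 < x v, \sum_v x v ^+ k = 1 & hpoly H x = spectral_radius H].

Definition extremal H : Prop :=
  k_angulation_hypergraph k H /\
  forall H', k_angulation_hypergraph k H' ->
    spectral_radius H' <= spectral_radius H.

Definition degree H (v : V) : nat := #|[set e in H | v \in e]|.

Definition rho : R := (k%:R * (3 * k%:R + 1))^-1.

End Spectral.

(* Main.v *)
Require Import Defs.
From HB Require Import structures.
From mathcomp Require Import all_boot all_order all_algebra all_fingroup.
From mathcomp Require Import all_classical all_reals all_analysis.
From mathcomp Require Import fintype finset.
From mathcomp Require Import zify ring lra.

(** Write [y v = x v ^+ k], let [f] be the number of faces and put
    [La = (4 f)^(1/k)], [d = f^(-rho)].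

    Lower bound.  In the fan, all faces share a hub and consecutive faces share
    a spoke.  Give the hub the mass [1/k], the other end of every spoke a mass
    [2t] and every other vertex a mass [t]; this yields
    [lambda^k >= 4 f - 8] (lemma [fan_spectral_radius]), hence
    [lambda >= La (1 - 2 d)].

    Upper bound.  The inequality of the means linearises the polynomial: if
    [c >= 0] has product at least 1 over a face [e], then
    [k * prod_e x <= sum_e c y] (lemma [weighted_AMGM]).  Let [L] be the set of
    heavy vertices, those with [y v >= d^k], together with [v1] and [v2].  For
    the faces around a heavy vertex [v] take [c v = al] and
    [c u = be / codegree u v].  A face has at most two vertices [u] that lie in
    a second face with [v], and never more than two faces contain both, so the
    product is at least [al * be^(k-1) / 4]; the codegree in the denominator
    makes every [u] count at most once.  Since every light vertex is charged to
    at most one heavy vertex, [al * be^(k-1) = 4] implies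

      [lambda <= al * sum_(v in L) d_v y_v + be * (1 - sum_(v in L) y_v) + error]

    (lemma [hpoly_bound]), where [d_v] counts the faces assigned to [v] and
    [sum_v d_v <= f].  The error comes from two kinds of faces.  One
    vertex can be removed from each face so that every vertex stays in at most
    three of the reduced faces; hence the faces without heavy vertices together
    contribute [O(d * f^(1/k))].  The faces at a heavy vertex in which another
    vertex shares a face with a second heavy vertex number [O(k |L|^2)], because
    at most [2k] vertices share faces with both of two given ones, and
    [|L| = O(d^(-k))].  The value of [rho] makes both terms [O(d * La)].

    Comparison.  With [al = La * tau^(k-1) / f] and [be = La / tau] the two
    bounds combine to

      [1 - C d <= tau^(k-1) * sum_(v in L) (d_v / f) y_v
                  + (1 - sum_(v in L) y_v) / tau].

    At [tau = 1] this reads [sum_(v in L) (1 - d_v / f) y_v <= C d], which bounds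
    [y v2], as [d_v1 + d_v2 <= f], and bounds [(1 - d_v1 / f) y v1].  The
    right-hand side has slope [k * y v1 - 1] in [tau] at 1 once [v1] dominates;
    taking [tau = 1 +- sqrt d] therefore pins [y v1] to [1/k] within
    [O(sqrt d)].

    Combinatorics.  The facts about faces used above hold for every
    hypergraph obtained by attaching polygons one after the other along boundary
    edges (the predicate [accretion]) and are proved by induction on this
    construction.  That a k-angulation arises in this way follows from Euler's
    formula.  A rank count turns the formula into exactness of the cochain complex
    over the field with two elements (lemma [edge_coboundary]).  Exactness shows
    that no face of a 2-connected plane graph visits a vertex twice, so that the
    interior faces are connected through shared edges and can be listed one
    neighbour at a time.  Each new face adds at most [k - 2] vertices, while Euler's
    formula forces at least [(k - 2) f + 2] vertices in all; so each new face
    meets the previous ones in exactly one edge. *)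

Set Implicit Arguments.
Unset Strict Implicit.
Unset Printing Implicit Defensive.

Import Order.TTheory GRing.Theory Num.Theory.

Local Open Scope ring_scope.

(** * Hypergraphs built by attaching polygons along boundary edges *)
Section Accretion.
Variables (V : finType) (k : nat).
Implicit Types (H B E : {set {set V}}) (e a : {set V}) (u v w p q : V).

Definition polygon e E : Prop :=
  (forall a, a \in E -> a \subset e /\ #|a| = 2%N) /\
  (forall v, #|[set a in E | v \in a]| <= 2)%N.

(** [accretion H B]: the faces [H] arise by attaching polygons one at a time,
    and the edges in [B] are those still free for an attachment.  A new face
    meets the old vertices only in the edge along which it is attached, and that
    edge is used up: this is a walk through the dual tree of the faces. *)
Inductive accretion : {set {set V}} -> {set {set V}} -> Prop :=
| accretion_base e E : #|e| = k -> polygon e E -> accretion [set e] E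
| accretion_step H B e E p q :
    accretion H B -> #|e| = k -> polygon e E ->
    [set p; q] \in B -> [set p; q] \in E -> e :&: cover H = [set p; q] ->
    accretion (e |: H) ((B :|: E) :\ [set p; q]).

Definition codegree H u v : nat := #|[set e in H | (u \in e) && (v \in e)]|.

Definition cofacial H u v : bool := [exists e in H, (u \in e) && (v \in e)].

Lemma mem_cover H e v : e \in H -> v \in e -> v \in cover H.
Proof. by move=> eH ve; apply/bigcupP; exists e. Qed.

Lemma cofacial_cover H u v : cofacial H u v -> u \in cover H /\ v \in cover H.
Proof. by case/existsP=> e /and3P[eH ue ve]; split; apply: mem_cover eH _. Qed.

Lemma codegree0_or_cofacial H u v : codegree H u v = 0%N \/ cofacial H u v.
Proof.
rewrite /codegree; case: (set_0Vmem [set e in H | (u \in e) && (v \in e)]).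
  by move=> ->; left; rewrite cards0.
case=> e; rewrite inE => /and3P[eH ue ve]; right.
by apply/existsP; exists e; rewrite eH ue ve.
Qed.

(** Makes the sides at [v] of a polygon correspond to their other ends. *)
Lemma pair_inj v : {in predC1 v &, injective (fun u => [set u; v])}.
Proof.
move=> u w /[!inE] uv wv E; have : u \in [set w; v] by rewrite -E set21.
by rewrite !inE (negbTE uv) orbF => /eqP.
Qed.

(** Used with [e] the set of old vertices of a new face: two distinct old
    vertices of that face are the ends of the edge of attachment. *)
Lemma sub_pair u v e p q :
  u != v -> u \in e -> v \in e -> e \subset [set p; q] -> [set u; v] = [set p; q].
Proof.
move=> uv ue ve es; apply/eqP; rewrite eqEcard.
rewrite !cards2 uv; apply/andP; split; last by case: (p != q).
by apply/subsetP=> x /set2P[] ->; apply: (subsetP es).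
Qed.

Lemma accretion_edge H B : accretion H B ->
  forall a, a \in B -> #|a| = 2%N /\ exists2 e, e \in H & a \subset e.
Proof.
elim=> [e E _ [PE _] a aE|{}H {}B e E p q _ IH _ [PE _] _ _ _ a].
  by have [ae a2] := PE _ aE; split=> //; exists e; rewrite ?set11.
rewrite !inE => /andP[_ /orP[aB|aE]].
  have [a2 [e' e'H ae']] := IH _ aB; split=> //.
  by exists e' => //; rewrite !inE e'H orbT.
by have [ae a2] := PE _ aE; split=> //; exists e; rewrite ?setU11.
Qed.

Lemma accretion_edge_cofacial H B u v :
  accretion H B -> [set u; v] \in B -> cofacial H u v.
Proof.
move=> acc /(accretion_edge acc)[_ [e eH /subsetP se]].
by apply/existsP; exists e; rewrite eH !se ?set21 ?set22.
Qed.

Lemma polygon_degree e E v :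
  polygon e E -> (#|[set u in e | (u != v) && ([set u; v] \in E)]| <= 2)%N.
Proof.
case=> _ /(_ v); apply: leq_trans.
rewrite -(card_in_imset (f := fun u => [set u; v])); last first.
  move=> u w; rewrite !inE => /and3P[_ uv _] /and3P[_ wv _].
  by apply: pair_inj; rewrite inE.
apply/subset_leq_card/subsetP => _ /imsetP[u uS ->].
by move: uS; rewrite !inE => /and3P[_ _ ->]; rewrite eqxx orbT.
Qed.

Lemma codegree_setU1 H e u v :
  (codegree (e |: H) u v <= ((u \in e) && (v \in e)) + codegree H u v)%N.
Proof.
rewrite /codegree; case: (boolP (_ && _)) => uve /=.
  rewrite -(cards1 e); apply: leq_trans (leq_card_setU _ _).
  apply/subset_leq_card/subsetP => e'; rewrite !inE.
  by case: (e' == e).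
apply/subset_leq_card/subsetP => e'; rewrite !inE.
by case: eqP => // ->; rewrite (negbTE uve).
Qed.

Lemma codegree_setU1_out H e u v :
  ~~ ((u \in e) && (v \in e)) -> (codegree (e |: H) u v <= codegree H u v)%N.
Proof. by move=> h; have := codegree_setU1 H e u v; rewrite (negbTE h). Qed.

(** Counting a free edge as one more face containing both of its ends makes the
    bound inductive: an attachment trades the free edge for a face. *)
Lemma accretion_codegree_edge H B u v : accretion H B -> u != v ->
  (codegree H u v + ([set u; v] \in B) <= 2)%N.
Proof.
move=> acc uv; elim: acc => [e E _ _|{}H {}B e E p q acc IH _ [PE _] pB pE eH].
  rewrite -[2%N]/(1 + 1)%N leq_add ?leq_b1 //.
  rewrite /codegree -(cards1 e) subset_leq_card //.
  by apply/subsetP => e' /[!inE] /andP[].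
have := codegree_setU1 H e u v; case: (boolP (_ && _)) => [/andP[ue ve]|nuve] /=.
  case: (boolP ([set u; v] == [set p; q])) => [/eqP uvp|uvp].
    move: IH; rewrite !inE uvp pB eqxx /=; lia.
  have -> : codegree H u v = 0%N.
    case: (codegree0_or_cofacial H u v) => // /cofacial_cover[uH vH].
    by case/eqP: uvp; apply: (@sub_pair _ _ (e :&: cover H)); rewrite ?inE ?ue ?ve ?eH.
  by case: (_ \in _); lia.
suff : ([set u; v] \in (B :|: E) :\ [set p; q] -> [set u; v] \in B).
  by move/implyP; case: (_ \in _) => /=; case: (_ \in _) IH => //=; lia.
rewrite !inE => /andP[_ /orP[//|/PE[/subsetP se _]]].
by move: nuve; rewrite !se ?set21 ?set22.
Qed.

Lemma accretion_codegree H B u v : accretion H B -> u != v ->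
  (codegree H u v <= 2)%N.
Proof.
by move=> acc uv; apply: leq_trans (accretion_codegree_edge acc uv); rewrite leq_addr.
Qed.

(** At a vertex [v] of a face, the neighbours across the two sides at [v] are
    the only vertices that can share a second face with [v].  As long as such a
    side is free its end counts too, so an attachment does not enlarge the set. *)
Lemma accretion_shared_edge H B e v : accretion H B -> e \in H -> v \in e ->
  (#|[set u in e | (u != v) && ((2 <= codegree H u v)%N || ([set u; v] \in B))]|
     <= 2)%N.
Proof.
move=> acc; elim: acc e => [e E _ PE e' /set1P -> ve|{}H {}B e E p q acc IH _ PE pB pE eH e'].
  apply: leq_trans (polygon_degree v PE); apply/subset_leq_card/subsetP => u.
  rewrite !inE => /and3P[-> -> /orP[|->//]]; rewrite leqNgt ltnS /codegree.
  rewrite -(cards1 e) subset_leq_card //.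
  by apply/subsetP => x /[!inE] /andP[].
have pq u w : u != w -> u \in e -> w \in e -> u \in cover H -> w \in cover H ->
    [set u; w] = [set p; q].
  move=> uw ue we uH wH; apply: (@sub_pair _ _ (e :&: cover H)) => //.
  - by rewrite inE ue.
  - by rewrite inE we.
  - by rewrite eH.
have [-> _ ve|e'e /setU1P[/eqP ee|e'H] ve] := eqVneq e' e; last 2 first.
- by rewrite (negbTE e'e) in ee.
- apply: leq_trans (IH _ e'H ve); apply/subset_leq_card/subsetP => u.
  rewrite !inE => /and3P[ue' uv h]; rewrite ue' uv /=.
  have uH := mem_cover e'H ue'; have vH := mem_cover e'H ve.
  have [/andP[ue ve']|nuve] := boolP ((u \in e) && (v \in e)).
    by rewrite (pq u v) // pB orbT.
  case/orP: h => [h|/andP[_ /orP[->|uvE]]]; rewrite ?orbT //.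
    by rewrite (leq_trans h) //; apply: codegree_setU1_out.
  have [/subsetP se _] := PE.1 _ uvE.
  by move: nuve; rewrite !se ?set21 ?set22.
apply: leq_trans (polygon_degree v PE); apply/subset_leq_card/subsetP => u.
rewrite !inE => /and3P[ue uv h]; rewrite ue uv /=.
have [cf|ncf] := boolP (cofacial H u v).
  by have [uH vH] := cofacial_cover cf; rewrite (pq u v).
case/orP: h => [h|/andP[_ /orP[uvB|->//]]].
  have := codegree_setU1 H e u v; rewrite ue ve.
  by have [->|] := codegree0_or_cofacial H u v; [lia|rewrite (negbTE ncf)].
by rewrite (accretion_edge_cofacial acc uvB) in ncf.
Qed.

Lemma accretion_shared H B e v : accretion H B -> e \in H -> v \in e ->
  (#|[set u in e | (u != v) && (2 <= codegree H u v)%N]| <= 2)%N.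
Proof.
move=> acc eH ve; apply: leq_trans (accretion_shared_edge acc eH ve).
apply/subset_leq_card/subsetP => u.
by rewrite !inE => /and3P[-> -> ->].
Qed.

(** The vertices near two given vertices [v] and [w]: they grow only when a face
    is attached along the edge [v w] itself, by at most [k], and this edge is
    then no longer free.  For a vertex just added, all vertices near it lie in
    the face that brought it. *)
Lemma accretion_cofacial_edge H B v w : accretion H B -> v != w ->
  (#|[set u | cofacial H u v && cofacial H u w]|
     <= if [set v; w] \in B then k else 2 * k)%N.
Proof.
move=> acc vw; have k2 (b : bool) : (k <= if b then k else 2 * k)%N by case: b; lia.
elim: acc => [e E ek _|{}H {}B e E p q acc IH ek PE pB pE eH].
  apply: leq_trans (k2 _); rewrite -ek subset_leq_card //; apply/subsetP => u.
  by rewrite inE => /andP[/existsP[e' /and3P[/set1P ->]]].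
have pq x y : x != y -> x \in e -> y \in e -> x \in cover H -> y \in cover H ->
    [set x; y] = [set p; q].
  move=> xy xe ye xH yH; apply: (@sub_pair _ _ (e :&: cover H)) => //.
  - by rewrite inE xe.
  - by rewrite inE ye.
  - by rewrite eH.
have cofU x y : cofacial (e |: H) x y -> (x \in e) && (y \in e) \/ cofacial H x y.
  case/existsP=> e' /andP[/setU1P[->|e'H] xy]; first by left.
  by right; apply/existsP; exists e'; rewrite e'H.
have new x : x \notin cover H -> forall u, cofacial (e |: H) u x -> u \in e.
  by move=> xH u /cofU[/andP[]//|/cofacial_cover[_]]; rewrite (negbTE xH).
have [vH|vH] := boolP (v \in cover H); last first.
  apply: leq_trans (k2 _); rewrite -ek subset_leq_card //; apply/subsetP => u.
  by rewrite inE => /andP[/(new _ vH)].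
have [wH|wH] := boolP (w \in cover H); last first.
  apply: leq_trans (k2 _); rewrite -ek subset_leq_card //; apply/subsetP => u.
  by rewrite inE => /andP[_ /(new _ wH)].
have [vwp|vwp] := eqVneq [set v; w] [set p; q].
  rewrite vwp !inE eqxx /=; rewrite vwp pB /= in IH.
  apply: (@leq_trans (#|e| + #|[set u | cofacial H u v && cofacial H u w]|)); last by lia.
  apply: leq_trans (leq_card_setU _ _); apply/subset_leq_card/subsetP => u.
  by rewrite !inE => /andP[/cofU[/andP[->//]|->] /cofU[/andP[->//]|->]]; rewrite orbT.
have nvw : ~~ ((v \in e) && (w \in e)).
  by apply: contra vwp => /andP[ve we]; apply/eqP/pq.
have old u x : u \in cover H -> x \in cover H -> cofacial (e |: H) u x -> cofacial H u x.
  move=> uH xH /cofU[/andP[ue xe]|//]; have [ux|ux] := eqVneq u x.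
    by case/bigcupP: uH => e' e'H ue'; apply/existsP; exists e'; rewrite e'H -ux ue'.
  by apply: accretion_edge_cofacial acc _; rewrite (pq u x).
apply: (@leq_trans #|[set u | cofacial H u v && cofacial H u w]|).
  apply/subset_leq_card/subsetP => u; rewrite !inE => /andP[uv uw].
  have [uH|uH] := boolP (u \in cover H); first by rewrite !old.
  have [/andP[_ ve]|/cofacial_cover[]] := cofU _ _ uv; last by rewrite (negbTE uH).
  have [/andP[_ we]|/cofacial_cover[]] := cofU _ _ uw; last by rewrite (negbTE uH).
  by rewrite ve we in nvw.
apply: leq_trans IH _; rewrite !inE vwp /=; case: (_ \in B) => //=.
case: ifP => // /PE.1[/subsetP se _].
by move: nvw; rewrite !se ?set21 ?set22.
Qed.

Lemma accretion_cofacial H B v w : accretion H B -> v != w ->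
  (#|[set u | cofacial H u v && cofacial H u w]| <= 2 * k)%N.
Proof.
move=> acc vw; apply: leq_trans (accretion_cofacial_edge acc vw) _.
by case: ifP => // _; lia.
Qed.

(** Every free edge [a] has a keeper [g a], the end that will be retained when a
    face is attached along [a]; the other end becomes the removed vertex [r e]
    of that face.  The keeper of a side of a new face is chosen among the new
    vertices, which lie on at most two sides.  So a vertex is retained once by
    the face that brought it and at most twice as a keeper. *)
Lemma accretion_keeper H B : (2 < k)%N -> accretion H B ->
  exists (r g : {set V} -> V),
  [/\ forall e, e \in H -> r e \in e, forall a, a \in B -> g a \in a &
      forall u, (#|[set e in H | (u \in e) && (u != r e)]| +
                 #|[set a in B | g a == u]| <= 3)%N].
Proof.
move=> k3; elim=> [e E ek PE|{}H {}B e E p q acc [r [g [rH gB cnt]]] ek PE pB pE eH].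
  have [x xe] : exists x, x \in e by apply/set0Pn; rewrite -card_gt0; lia.
  exists (fun=> x), (fun a => odflt x [pick y in a]).
  have pickE a : a \in E -> odflt x [pick y in a] \in a.
    case: pickP => [//|a0 aE]; have [_] := PE.1 _ aE.
    by move/eqP; rewrite (eq_card0 a0).
  split=> [e' /set1P -> //|//|u]; rewrite -[3%N]/(1 + 2)%N leq_add //.
    rewrite -(cards1 e) subset_leq_card //; apply/subsetP => e'.
    by rewrite inE => /andP[].
  apply: leq_trans (PE.2 u); apply/subset_leq_card/subsetP => a.
  by rewrite !inE => /andP[aE /eqP <-]; rewrite aE pickE.
have eNH : e \notin H.
  apply/negP => eH'; have : e :&: cover H = e.
    by apply/setIidPl; apply: bigcup_sup.
  rewrite eH => ee; move: ek; rewrite -ee cards2; case: (_ != _); lia.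
(* Every side other than the edge of attachment has a new end. *)
have EH a : a \in E -> a != [set p; q] -> exists2 y, y \in a & y \notin cover H.
  move=> aE ap; apply/subsetPn/negP => aH; have [ae a2] := PE.1 _ aE.
  case/eqP: ap; apply/eqP; rewrite eqEcard -eH subsetI ae aH a2 eH cards2.
  by case: (_ != _).
set c := g [set p; q]; have cpq : c \in [set p; q] by apply: gB.
exists (fun e' => if e' == e then (if c == p then q else p) else r e').
exists (fun a => if a \in B then g a else odflt p [pick y in a :\: cover H]).
have gE a : a \notin B -> a \in E -> a != [set p; q] ->
    odflt p [pick y in a :\: cover H] \in a :\: cover H.
  move=> _ aE /(EH _ aE)[y ya yH]; case: pickP => // /(_ y).
  by rewrite inE ya yH.
split.
- move=> e' /setU1P[->|e'H]; last first.
    by case: eqP => [ee|_]; [rewrite -ee e'H in eNH|apply: rH].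
  rewrite eqxx; have : [set p; q] \subset e by rewrite -eH subsetIl.
  by move/subsetP=> s; case: ifP => _; apply: s; rewrite ?set21 ?set22.
- move=> a; rewrite !inE => /andP[ap aBE]; case: (boolP (a \in B)) => [/gB//|aB].
  have aE : a \in E by move: aBE; rewrite (negbTE aB).
  by have := gE _ aB aE ap; rewrite inE => /andP[].
move=> u; have [uH|uH] := boolP (u \in cover H); last first.
  rewrite -[3%N]/(1 + 2)%N leq_add //.
    rewrite -(cards1 e) subset_leq_card //; apply/subsetP => e'.
    rewrite !inE => /andP[/orP[//|e'H] /andP[ue' _]].
    by rewrite (mem_cover e'H ue') in uH.
  apply: leq_trans (PE.2 u); apply/subset_leq_card/subsetP => a.
  rewrite !inE => /andP[/andP[ap aBE]]; case: (boolP (a \in B)) => [aB /eqP gu|aB /eqP gu].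
    case/negP: uH; have [_ [e' e'H /subsetP ae']] := accretion_edge acc aB.
    by apply: (mem_cover e'H); apply: ae'; rewrite -gu; apply: gB.
  have aE : a \in E by move: aBE; rewrite (negbTE aB).
  by rewrite aE; have := gE _ aB aE ap; rewrite inE gu => /andP[].
set L := [set e' in _ | _]; set L' := [set a in _ | _].
have sL' : L' \subset [set a in B | g a == u] :\ [set p; q].
  apply/subsetP => a; rewrite !inE => /andP[/andP[ap aBE]] h.
  rewrite ap; move: h; case: (boolP (a \in B)) => [//|aB /eqP gu].
  have aE : a \in E by move: aBE; rewrite (negbTE aB).
  by have := gE _ aB aE ap; rewrite inE gu uH.
have sL : L \subset (if u == c then [set e] else finset.set0) :|:
                    [set e' in H | (u \in e') && (u != r e')].
  apply/subsetP => e'; rewrite !inE => /andP[/orP[/eqP ->|e'H]]; last first.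
    case: (eqVneq e' e) => [ee|_ h]; first by rewrite ee (negbTE eNH) in e'H.
    by rewrite e'H h orbT.
  rewrite eqxx => /andP[ue ur].
  have : u \in [set p; q] by rewrite -eH inE ue.
  move: cpq ur; rewrite !inE; case: (eqVneq u c) => [_|uc]; first by rewrite set11.
  case: (eqVneq c p) => [cp|cp] /= ; first by rewrite -cp (negbTE uc) /= => _ /negbTE->.
  by move/eqP=> cq; rewrite -cq (negbTE uc) orbF => /negbTE->.
apply: leq_trans (cnt u).
have D1 := cardsD1 [set p; q] [set a in B | g a == u].
have pqB : ([set p; q] \in [set a in B | g a == u]) = (u == c).
  by rewrite inE pB eq_sym.
rewrite pqB in D1.
have D2 := leq_trans (subset_leq_card sL) (leq_card_setU _ _).
have D3 := subset_leq_card sL'.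
apply: leq_trans (leq_add D2 D3) _; rewrite D1 addnA leq_add2r addnC leq_add2l.
by case: (u == c); rewrite ?cards1 ?cards0.
Qed.

Lemma accretion_choice H B : (2 < k)%N -> accretion H B ->
  exists r : {set V} -> V, (forall e, e \in H -> r e \in e) /\
    forall u, (#|[set e in H | (u \in e) && (u != r e)]| <= 3)%N.
Proof.
move=> k3 /(accretion_keeper k3)[r [g [rH _ cnt]]]; exists r; split=> // u.
by apply: leq_trans (cnt u); rewrite leq_addr.
Qed.

Lemma accretion_card H B e : accretion H B -> e \in H -> #|e| = k.
Proof.
move=> acc; elim: acc e => [e E ek _ e' /set1P -> //|{}H {}B e E p q _ IH ek _ _ _ _ e'].
by case/setU1P => [->|/IH].
Qed.

End Accretion.

(** * Plane graphs as rotation systems *)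
Lemma connect_ind (T : finType) (e : rel T) (P : T -> Prop) (u w : T) :
  P u -> (forall x y, e x y -> P x -> P y) -> connect e u w -> P w.
Proof.
move=> Pu step /connectP[p ep ->]; elim: p u Pu ep => //= x p IH u Pu /andP[ux].
by apply: IH; apply: step ux Pu.
Qed.

Lemma F2_addrr (x : 'F_2) : x + x = 0.
Proof. by apply/eqP; case: x => [[|[|]]]. Qed.

Lemma F2_addr_eq0 (x y : 'F_2) : x + y = 0 -> x = y.
Proof. by move=> xy; rewrite -[LHS]addr0 -(F2_addrr y) addrA xy add0r. Qed.

(** Exactness of [F^n -> F^m -> F^p] in the middle from a dimension count: if the
    kernel of the first map and the cokernel of the second have dimension at most
    one, then the ranks add up to at least [(n - 1) + (p - 1) = m]. *)
Lemma exact_of_corank (F : fieldType) (n m p : nat)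
    (A : 'M[F]_(n, m)) (B : 'M[F]_(m, p)) :
  A *m B = 0 ->
  (forall z : 'rV_n, z *m A = 0 -> (z <= (const_mx 1 : 'rV_n))%MS) ->
  (forall z : 'rV_p, z *m B^T = 0 -> (z <= (const_mx 1 : 'rV_p))%MS) ->
  (n + p = m + 2)%N ->
  forall y : 'rV_m, y *m B = 0 -> exists h : 'rV_n, y = h *m A.
Proof.
have corank a b (C : 'M[F]_(a, b)) :
    (forall z : 'rV_a, z *m C = 0 -> (z <= (const_mx 1 : 'rV_a))%MS) ->
    (a - \rank C <= 1)%N.
  move=> hC; rewrite -mxrank_ker; apply: leq_trans (rank_leq_row (const_mx 1 : 'rV[F]_a)).
  apply/mxrankS/row_subP => i; apply: hC; apply/eqP.
  by rewrite -sub_kermx row_sub.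
move=> AB /corank cA /corank; rewrite mxrank_tr => cB npm y yB.
have AkB : (A <= kermx B)%MS by apply/sub_kermxP.
have kBA : (kermx B <= A)%MS.
  rewrite -(geq_leqif (mxrank_leqif_sup AkB)) mxrank_ker.
  by have := rank_leq_row B; lia.
apply/submxP; apply: submx_trans kBA; exact/sub_kermxP.
Qed.

Section Rotation.
Variables (V : finType) (G : embedded_graph V).
Implicit Types (u v w a b : V) (d : V * V) (F O : {set V * V}).

Let next := face_next G.
Definition rev_dart d : V * V := (d.2, d.1).
Definition dart_edge d : {set V} := [set d.1; d.2].

Lemma rev_dartK : involutive rev_dart. Proof. by case. Qed.

Lemma mem_darts d : (d \in darts G) = adj G d.1 d.2.
Proof. by rewrite inE. Qed.

Lemma rev_dart_darts d : (rev_dart d \in darts G) = (d \in darts G).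
Proof. by rewrite !mem_darts adj_sym. Qed.

Lemma rot_adj u v : adj G u v -> adj G u (Defs.rot G u v).
Proof.
move=> uv; rewrite -(rotP (Defs.rot G u v) uv).
by have := mem_porbit (Defs.rot G u) 1 v; rewrite expg1.
Qed.

Lemma rotX_adj u v i : adj G u v -> adj G u ((Defs.rot G u ^+ i)%g v).
Proof. by move=> uv; rewrite -(rotP _ uv) mem_porbit. Qed.

Lemma face_next_inj : injective next.
Proof. by case=> [u v] [u' v'] [-> /perm_inj ->]. Qed.

Lemma face_next_darts d : d \in darts G -> next d \in darts G.
Proof. by rewrite !mem_darts /= => dd; apply: rot_adj; rewrite adj_sym. Qed.

Lemma mem_face_at d d' : (d' \in face_at G d) = fconnect next d d'.
Proof. by rewrite inE. Qed.

Lemma face_at_self d : d \in face_at G d.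
Proof. by rewrite mem_face_at connect0. Qed.

Lemma face_at_eq d d' : d' \in face_at G d -> face_at G d' = face_at G d.
Proof.
rewrite mem_face_at => dd'; apply/setP => x; rewrite !mem_face_at.
by rewrite (same_connect (fconnect_sym face_next_inj) dd').
Qed.

Lemma face_at_next d : face_at G (next d) = face_at G d.
Proof. by apply: face_at_eq; rewrite mem_face_at fconnect1. Qed.

Lemma face_at_darts d d' : d \in darts G -> d' \in face_at G d -> d' \in darts G.
Proof.
move=> dD; rewrite mem_face_at.
apply: (@connect_ind _ _ (fun x => x \in darts G) d d') => // x y /eqP <-.
exact: face_next_darts.
Qed.

Lemma mem_faces F d : F \in faces G -> d \in F -> d \in darts G /\ face_at G d = F.
Proof.
by case/imsetP=> d0 dD -> dF; split; [apply: face_at_darts dF|apply: face_at_eq].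
Qed.

Lemma face_at_faces d : d \in darts G -> face_at G d \in faces G.
Proof. exact: imset_f. Qed.

Lemma face_mem_next F d : F \in faces G -> (next d \in F) = (d \in F).
Proof.
case/imsetP=> d0 dD ->; rewrite !mem_face_at.
by rewrite -(same_fconnect1_r face_next_inj).
Qed.

Lemma faces_partition : partition (faces G) (darts G).
Proof.
apply/and3P; split.
- rewrite /cover; apply/eqP/setP => d; apply/bigcupP/idP => [[F FF dF]|dD].
    by have [] := mem_faces FF dF.
  by exists (face_at G d); [apply: face_at_faces|apply: face_at_self].
- apply/trivIsetP => F F' FF FF' ne; rewrite -setI_eq0; apply/eqP/setP => d.
  rewrite !inE; apply/negP => /andP[/(mem_faces FF)[_ e] /(mem_faces FF')[_ e']].
  by rewrite -e e' eqxx in ne.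
- by apply/imsetP => -[d _ e0]; have := face_at_self d; rewrite -e0 inE.
Qed.

Lemma dart_edge_rev d : dart_edge (rev_dart d) = dart_edge d.
Proof. by rewrite /dart_edge setUC. Qed.

Lemma dart_edge_eq d d' : d \in darts G -> d' \in darts G ->
  dart_edge d = dart_edge d' -> d' = d \/ d' = rev_dart d.
Proof.
case: d d' => [u v] [a b]; rewrite !mem_darts /dart_edge /rev_dart /= => uv ab E.
have uv' : u != v by apply: contraTneq uv => ->; rewrite adj_irrefl.
have := set21 a b; have := set22 a b; rewrite -E !inE.
have ab' : a != b by apply: contraTneq ab => ->; rewrite adj_irrefl.
case/orP=> /eqP bE /orP[] /eqP aE; move: ab'; rewrite aE bE ?eqxx //; by [left|right].
Qed.

Lemma dart_edge_edges d : d \in darts G -> dart_edge d \in edges G.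
Proof. exact: imset_f. Qed.

Lemma dart_neq_rev d : d \in darts G -> d != rev_dart d.
Proof.
case: d => u v; rewrite mem_darts /= => uv; apply/eqP => -[E _].
by rewrite E adj_irrefl in uv.
Qed.

Lemma darts_of_edge d : d \in darts G ->
  [set d' in darts G | dart_edge d' == dart_edge d] = [set d; rev_dart d].
Proof.
move=> dD; apply/setP => d'; rewrite in_set in_set2; apply/andP/orP.
  case=> d'D /eqP/esym/(dart_edge_eq dD d'D)[]->; rewrite eqxx; by [left|right].
by case=> /eqP ->; rewrite ?rev_dart_darts ?dart_edge_rev.
Qed.

Lemma card_darts : #|darts G| = (2 * #|edges G|)%N.
Proof.
rewrite -sum1_card (partition_big dart_edge (mem (edges G))) /=; last exact: dart_edge_edges.
rewrite mulnC -sum_nat_const; apply: eq_bigr => _ /imsetP[d dD ->].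
by rewrite sum1dep_card darts_of_edge // cards2 dart_neq_rev.
Qed.

Lemma sum_face_snd (R : nmodType) F (phi : V -> R) : F \in faces G ->
  \sum_(d in F) phi d.2 = \sum_(d in F) phi d.1.
Proof.
move=> FF; rewrite [RHS](reindex_inj face_next_inj) /=.
by apply: eq_bigl => d; rewrite face_mem_next.
Qed.

(** The corner at [v] between two consecutive neighbours belongs to one face, so
    a quantity that is constant on faces and does not change across edges is
    constant around every vertex; connectedness of the graph does the rest. *)
Lemma dual_connected (T : Type) (z : V * V -> T) : connected_off G finset.set0 ->
  (forall d, d \in darts G -> z (next d) = z d) ->
  (forall d, d \in darts G -> z (rev_dart d) = z d) ->
  forall d d', d \in darts G -> d' \in darts G -> z d = z d'.
Proof.
move=> conn zn zr [u a] [w b]; rewrite !mem_darts /= => ua wb.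
have zrot x y y' : adj G x y -> adj G x y' -> z (x, y') = z (x, y).
  move=> xy; rewrite -(rotP _ xy) => /porbitP[i ->]; elim: i => [|i IH].
    by rewrite expg0 perm1.
  rewrite expgSr permM -IH; have xi := rotX_adj i xy.
  rewrite -[RHS]zr ?mem_darts // -[RHS]zn ?mem_darts //=.
  by rewrite adj_sym.
have : connect [rel a b | [&& adj G a b, a \notin finset.set0 & b \notin finset.set0]] u w.
  by apply: conn; rewrite inE.
move=> /(@connect_ind _ _ (fun x => forall c, adj G x c -> z (u, a) = z (x, c))) H.
apply: (H _ _ b wb) => [c uc|x y /= /and3P[xy _ _] Hx c yc]; first exact: zrot.
have yx : adj G y x by rewrite adj_sym.
by rewrite (zrot y x c) // -[RHS]zr ?mem_darts //; apply: Hx.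
Qed.

Hypothesis planeG : plane G.

(** Euler's formula as a discrete Poincare lemma: over the field with two elements,
    where orientations do not matter, an edge function with zero sum along every
    face boundary is the coboundary of a vertex function.  The two hypotheses of
    [exact_of_corank] are the connectedness of the graph and of its dual. *)
Lemma edge_coboundary (g : V -> V -> 'F_2) : (forall u v, g u v = g v u) ->
  (forall F, F \in faces G -> \sum_(d in F) g d.1 d.2 = 0) ->
  exists h : V -> 'F_2, forall u v, adj G u v -> g u v = h u + h v.
Proof.
move=> gS gF; have [conn euler] := planeG.
pose bd F (a : {set V}) : 'F_2 := \sum_(d in F) (dart_edge d == a)%:R.
pose A : 'M['F_2]_(#|V|, #|edges G|) :=
  \matrix_(i, j) ((enum_val i : V) \in (enum_val j : {set V}))%:R.
pose B : 'M['F_2]_(#|edges G|, #|faces G|) := \matrix_(i, j) bd (enum_val j) (enum_val i).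
have sumE (phi : {set V} -> 'F_2) d : d \in darts G ->
    \sum_(j < #|edges G|) phi (enum_val j) * (dart_edge d == enum_val j)%:R = phi (dart_edge d).
  move=> dD; rewrite -(big_enum_val (A:=mem (edges G)) (fun a : {set V} => phi a * (dart_edge d == a)%:R)) /=.
  rewrite (bigD1 (dart_edge d)) ?dart_edge_edges //= eqxx mulr1 big1 ?addr0 // => a.
  by rewrite eq_sym => /andP[_ /negbTE ->]; rewrite mulr0.
have sumB (phi : {set V} -> 'F_2) F : F \in faces G ->
    \sum_(j < #|edges G|) phi (enum_val j) * bd F (enum_val j)
      = \sum_(d in F) phi (dart_edge d).
  move=> FF; under eq_bigr do rewrite mulr_sumr.
  rewrite exchange_big /=; apply: eq_bigr => d dF; apply: sumE.
  by have [] := mem_faces FF dF.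
have sum2 (phi : V -> 'F_2) u v : u != v ->
    \sum_(x : V) phi x * (x \in [set u; v])%:R = phi u + phi v.
  move=> uv; rewrite (bigD1 u) //= (bigD1 v) ?(eq_sym v) //= set21 set22 !mulr1.
  rewrite big1 ?addr0 // => x /andP[xu xv].
  by rewrite !inE (negbTE xu) (negbTE xv) mulr0.
have adj_neq u v : adj G u v -> u != v.
  by move=> uv; apply: contraTneq uv => ->; rewrite adj_irrefl.
have sumA (z : 'rV['F_2]_#|V|) j d : d \in darts G -> enum_val j = dart_edge d ->
    (z *m A) 0 j = z 0 (enum_rank d.1) + z 0 (enum_rank d.2).
  move=> dD jd; rewrite mxE; under eq_bigr do rewrite mxE.
  rewrite -(sum2 (fun x => z 0 (enum_rank x)) d.1 d.2); last first.
    by apply: adj_neq; rewrite -mem_darts.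
  rewrite (reindex (@enum_val _ (mem V))) /=; last first.
    by exists enum_rank => x _; [apply: enum_valK|apply: enum_rankK].
  by apply: eq_bigr => i _; rewrite enum_valK jd.
have edgeI d : d \in darts G -> exists j : 'I_#|edges G|, enum_val j = dart_edge d.
  move=> dD; have dE := dart_edge_edges dD.
  by exists (enum_rank_in dE (dart_edge d)); rewrite enum_rankK_in.
pose gE (a : {set V}) := if [pick d | (d \in darts G) && (dart_edge d == a)] is Some d
             then g d.1 d.2 else 0.
have gEE d : d \in darts G -> gE (dart_edge d) = g d.1 d.2.
  move=> dD; rewrite /gE; case: pickP => [d' /andP[d'D /eqP/esym E]|/(_ d)].
    by have [->//|->] := dart_edge_eq dD d'D E; apply: gS.
  by rewrite dD eqxx.
pose y : 'rV['F_2]_#|edges G| := \row_j gE (enum_val j).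
have [] := @exact_of_corank _ _ _ _ A B _ _ _ euler y.
- apply/matrixP => i j; rewrite !mxE; set F := enum_val j : {set V * V}.
  have FF : F \in faces G by apply: enum_valP.
  transitivity (\sum_(l < #|edges G|) (enum_val i \in enum_val l)%:R * bd F (enum_val l)).
    by apply: eq_bigr => l _; rewrite !mxE.
  rewrite (sumB (fun a : {set V} => (enum_val i \in a)%:R) F FF).
  rewrite -[RHS](F2_addrr (\sum_(d in F) (enum_val i == d.1)%:R)).
  rewrite -{2}(sum_face_snd (fun x => (enum_val i == x)%:R) FF) -big_split /=.
  apply: eq_bigr => d dF; rewrite !inE.
  have [dD _] := mem_faces FF dF; have := adj_neq d.1 d.2; rewrite -mem_darts => /(_ dD).
  case: (eqVneq (enum_val i : V) d.1) => [->|_ _] /=; last by rewrite ?add0r.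
  by move/negbTE=> ->; rewrite ?addr0.
- move=> z zA; have zE u v : adj G u v -> z 0 (enum_rank u) = z 0 (enum_rank v).
    move=> uv; have dD : (u, v) \in darts G by rewrite mem_darts.
    have [j jE] := edgeI _ dD; apply: F2_addr_eq0.
    by rewrite -(sumA z j (u, v)) // zA mxE.
  apply/sub_rVP; case: (pickP (fun i : 'I_#|V| => true)) => [i _|i0]; last first.
    by exists 0; apply/rowP => i; have := i0 i.
  exists (z 0 i); apply/rowP => j; rewrite !mxE mulr1.
  rewrite -(enum_valK i) -(enum_valK j).
  have : connect [rel a b | [&& adj G a b, a \notin finset.set0 & b \notin finset.set0]] (enum_val i) (enum_val j).
    by apply: conn; rewrite inE.
  move=> /(@connect_ind _ _ (fun x => z 0 (enum_rank x) = z 0 (enum_rank (enum_val i)))) -> //.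
  by move=> a b /= /and3P[ab _ _] <-; apply/esym/zE.
- move=> z zB; apply/sub_rVP.
  case: (pickP (fun i : 'I_#|faces G| => true)) => [i _|i0]; last first.
    by exists 0; apply/rowP => i; have := i0 i.
  exists (z 0 i); apply/rowP => j; rewrite !mxE mulr1.
  pose zf F := z 0 (enum_rank_in (enum_valP i) F).
  have zfE l : z 0 l = zf (enum_val l) by rewrite /zf enum_valK_in.
  have zr d : d \in darts G -> zf (face_at G (rev_dart d)) = zf (face_at G d).
    move=> dD; apply: F2_addr_eq0; have [l lE] := edgeI _ dD.
    have := congr1 (fun M : 'rV_ _ => M 0 l) zB; rewrite !mxE => <-.
    transitivity (\sum_(l' < #|faces G|) zf (enum_val l') * bd (enum_val l') (dart_edge d)).
      rewrite -(big_enum_val (A:=mem (faces G)) (fun F => zf F * bd F (dart_edge d))) /=.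
      under eq_bigr do rewrite mulr_sumr.
      transitivity (\sum_(x in darts G) zf (face_at G x) * (dart_edge x == dart_edge d)%:R).
        rewrite [RHS](bigID (fun x => dart_edge x == dart_edge d)) /=.
        rewrite [X in _ = _ + X]big1 ?addr0; last by move=> x /andP[_ /negbTE ->]; rewrite mulr0.
        under eq_bigl => x do rewrite -(in_set (fun x => (x \in darts G) && (dart_edge x == dart_edge d))).
        rewrite darts_of_edge // big_setU1 ?big_set1 /= ?dart_edge_rev ?eqxx ?mulr1 1?addrC //.
        by rewrite in_set1 dart_neq_rev.
      rewrite (set_partition_big _ faces_partition) /=.
      apply: eq_bigr => F FF; apply: eq_bigr => x xF.
      by have [_ ->] := mem_faces FF xF.
    by apply: eq_bigr => l' _; rewrite !mxE -zfE lE.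
  rewrite !zfE; have /imsetP[d dD ->] := enum_valP i.
  have /imsetP[d' d'D ->] := enum_valP j.
  apply: (dual_connected (z := fun d => zf (face_at G d)) conn) => // x _.
  by rewrite face_at_next.
- apply/rowP => j; rewrite !mxE; set F := enum_val j : {set V * V}.
  have FF : F \in faces G by apply: enum_valP.
  transitivity (\sum_(l < #|edges G|) gE (enum_val l) * bd F (enum_val l)).
    by apply: eq_bigr => l _; rewrite !mxE.
  rewrite (sumB gE F FF) -[RHS](gF F FF); apply: eq_bigr => d dF; apply: gEE.
  by have [] := mem_faces FF dF.
move=> h yE; exists (fun v => h 0 (enum_rank v)) => u v uv.
have dD : (u, v) \in darts G by rewrite mem_darts.
have [j jE] := edgeI _ dD; rewrite -(sumA h j (u, v)) // -yE mxE jE.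
by rewrite gEE.
Qed.

Lemma sum_face_next (R : nmodType) F (phi : V * V -> R) : F \in faces G ->
  \sum_(d in F) phi (next d) = \sum_(d in F) phi d.
Proof.
move=> FF; rewrite [RHS](reindex_inj face_next_inj) /=.
by apply: eq_bigl => d; rewrite face_mem_next.
Qed.

(** For two points [a] and [b] of one cycle of a permutation, the arc [A] from
    [a] to just before [b] has boundary exactly [a] and [b]. *)
Lemma arc_boundary (T : finType) (r : {perm T}) (a b : T) :
  b \in porbit r a -> a != b ->
  exists A : {set T}, [/\ a \in A, b \notin A &
    forall c, ((c \in A)%:R + (r^-1%g c \in A)%:R : 'F_2)
              = (c == a)%:R + (c == b)%:R].
Proof.
move=> /porbitP bex ab.
have ex : exists m, b == (r ^+ m)%g a by case: bex => m ->; exists m.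
(* Minimality of [m] keeps the arc from going around the cycle. *)
case: (ex_minnP ex) => m /eqP bm mmin.
have m0 : (0 < m)%N.
  by rewrite lt0n; apply: contraNneq ab => m0; rewrite bm m0 expg0 perm1.
pose A := [set (r ^+ val i)%g a | i in 'I_m].
have inA i : (i < m)%N -> (r ^+ i)%g a \in A.
  by move=> im; apply/imsetP; exists (Ordinal im).
have AP c : c \in A -> exists2 i, (i < m)%N & c = (r ^+ i)%g a.
  by case/imsetP=> i _ ->; exists (val i); first exact: ltn_ord.
have bA : b \notin A.
  by apply/negP => /AP[i im bi]; have := mmin i; rewrite bi eqxx; lia.
have aA : a \in A by have := inA 0%N m0; rewrite expg0 perm1.
have stepA c : c \in A -> r c != b -> r c \in A.
  case/AP=> i im -> rb; rewrite -permM -expgSr; apply: inA.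
  rewrite ltn_neqAle im andbT; apply: contraNneq rb => im1.
  by rewrite bm -im1 expgSr permM.
have aNA : r^-1%g a \notin A.
  apply/negP => /AP[i im ai].
  have ra : (r ^+ i.+1)%g a = a by rewrite expgSr permM -ai permKV.
  have : b == (r ^+ (m - i.+1))%g a.
    by rewrite bm -[X in (r ^+ X)%g](@subnKC i.+1 m) // expgD permM ra.
  by move/mmin; lia.
have bNA : r^-1%g b \in A.
  have -> : r^-1%g b = (r ^+ m.-1)%g a.
    by apply: (@perm_inj _ r); rewrite permKV -permM -expgSr prednK.
  by apply: inA; lia.
exists A; split=> // c.
have [->|ca] := eqVneq c a; first by rewrite aA (negbTE aNA) (negbTE ab).
have [->|cb] := eqVneq c b; first by rewrite bNA (negbTE bA) addrC.
suff -> : (c \in A) = (r^-1%g c \in A) by rewrite F2_addrr addr0.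
apply/idP/idP => [/AP[i im ci]|/stepA]; last by rewrite permKV; apply.
have i0 : (0 < i)%N.
  by rewrite lt0n; apply: contraNneq ca => i0; rewrite ci i0 expg0 perm1.
have -> : r^-1%g c = (r ^+ i.-1)%g a.
  by apply: (@perm_inj _ r); rewrite permKV -permM -expgSr prednK.
by apply: inA; lia.
Qed.

Hypothesis G2 : two_connected G.

Lemma sum_indicator_eq (T : finType) (F : {set T}) (x : T) :
  \sum_(d in F) ((d == x)%:R : 'F_2) = (x \in F)%:R.
Proof.
have [xF|xF] := boolP (x \in F).
  by rewrite (bigD1 x) //= eqxx big1 ?addr0 // => y /andP[_ /negbTE ->].
by rewrite big1 // => y yF; case: eqP => // yx; rewrite yx (negbTE xF) in yF.
Qed.

(** Suppose the walk around [F] passes [v] twice, before the neighbours [a] and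
    [b].  The cochain supported on the edges from [v] to the arc from [a] to [b]
    changes only at these two corners, which lie on the same face, so its sum
    along every face is zero and it is a coboundary.  The potential is constant
    off [v] because [G - v] is connected; hence [v a] and [v b] get the same
    value, although exactly one of them is in the support. *)
Lemma face_visits_once F v a b : F \in faces G ->
  (v, a) \in F -> (v, b) \in F -> a = b.
Proof.
move=> FF aF bF; apply/eqP/negP => /negP ab.
have [aD Fa] := mem_faces FF aF; have [bD Fb] := mem_faces FF bF.
rewrite mem_darts /= in aD; rewrite mem_darts /= in bD.
have [A [aA bA Ac]] : exists A : {set V}, [/\ a \in A, b \notin A &
    forall c, ((c \in A)%:R + ((Defs.rot G v)^-1%g c \in A)%:R : 'F_2)
              = (c == a)%:R + (c == b)%:R].
  by apply: arc_boundary => //; rewrite rotP.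
pose g x y : 'F_2 := ((x == v) && (y \in A))%:R + ((y == v) && (x \in A))%:R.
have [||h hg] := @edge_coboundary g.
- by move=> x y; rewrite /g addrC.
- move=> F' FF'; rewrite big_split /=.
  pose phi (d : V * V) : 'F_2 := ((d.1 == v) && ((Defs.rot G v)^-1%g d.2 \in A))%:R.
  have -> : \sum_(d in F') (((d.2 == v) && (d.1 \in A))%:R : 'F_2)
            = \sum_(d in F') phi (next d).
    apply: eq_bigr => d _; rewrite /phi /=; case: eqVneq => //= ->.
    by rewrite permK.
  rewrite sum_face_next // -big_split /=.
  transitivity (\sum_(d in F') ((d == (v, a))%:R + (d == (v, b))%:R : 'F_2)).
    apply: eq_bigr => -[x y] _; rewrite /phi /= !xpair_eqE.
    by case: eqVneq => //= _; rewrite ?addr0.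
  rewrite big_split /= !sum_indicator_eq.
  have mF d : d \in F -> (d \in F') = (F == F').
    move=> dF; have [dD dF1] := mem_faces FF dF.
    apply/idP/eqP => [dF'|<-//]; have [_ <-] := mem_faces FF' dF'; exact: esym.
  by rewrite !mF // F2_addrr.
have neq x y : adj G x y -> x != y.
  by move=> xy; apply: contraTneq xy => ->; rewrite adj_irrefl.
have va : g v a = 1 by rewrite /g eqxx aA (eq_sym a) (negbTE (neq _ _ aD)) addr0.
have vb : g v b = 0 by rewrite /g eqxx (negbTE bA) (eq_sym b) (negbTE (neq _ _ bD)) addr0.
have hab : h b = h a.
  have : connect [rel x y | [&& adj G x y, x \notin [set v] & y \notin [set v]]] a b.
    by apply: G2.2; rewrite ?cards1 // inE eq_sym neq.
  move=> /(@connect_ind _ _ (fun x => h x = h a)) -> // x y /= /and3P[xy].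
  rewrite !inE => xv yv <-; apply/esym/F2_addr_eq0; rewrite -hg //.
  by rewrite /g (negbTE xv) (negbTE yv) addr0.
by have := hg _ _ aD; rewrite va -hab -hg // vb.
Qed.

Lemma two_connected_degree v a : exists2 b, adj G v b & b != a.
Proof.
have [n3 conn] := G2.
have [va|va] := eqVneq v a.
  have [w] : exists w, w \notin [set v].
    by apply/existsP; rewrite -negb_forall; apply/negP => /forallP all1;
       have := subset_leq_card (introT subsetP (fun x (_ : x \in [set: V]) => all1 x));
       rewrite cardsT cards1; lia.
  rewrite inE => wv; have := conn finset.set0 _ v w; rewrite cards0 !inE => /(_ isT isT isT).
  case/connectP=> -[/= _ wE|b p /= /andP[/and3P[vb _ _] _] _]; first by rewrite wE eqxx in wv.
  by exists b => //; apply: contraTneq vb => ->; rewrite va adj_irrefl.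
have [w] : exists w, w \notin [set v; a].
  apply/existsP; rewrite -negb_forall; apply/negP => /forallP all1.
  have := subset_leq_card (introT subsetP (fun x (_ : x \in [set: V]) => all1 x)).
  by rewrite cardsT cards2; case: (_ != _); lia.
rewrite !inE negb_or => /andP[wv wa].
have := conn [set a] _ v w; rewrite cards1 !inE => /(_ isT va wa).
case/connectP=> -[/= _ wE|b p /= /andP[/and3P[vb _ ba] _] _]; first by rewrite wE eqxx in wv.
by exists b => //; rewrite inE in ba.
Qed.

Lemma rev_dart_other_face F u w : F \in faces G ->
  (u, w) \in F -> (w, u) \notin F.
Proof.
move=> FF uw; apply/negP => wu; have [uwD _] := mem_faces FF uw.
have wuD : adj G w u by rewrite adj_sym -(mem_darts (u, w)).
have nx : (w, Defs.rot G w u) \in F by rewrite -(face_mem_next _ FF) /= in uw.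
have fixu := face_visits_once FF nx wu.
have [b wb bu] := two_connected_degree w u.
move: wb; rewrite -(rotP b wuD) => /porbitP[i bi].
have : (Defs.rot G w ^+ i)%g u = u.
  by elim: {bi} i => [|i IH]; rewrite ?expg0 ?perm1 // expgSr permM IH.
by move=> E; rewrite bi E eqxx in bu.
Qed.

Variable O : {set V * V}.
Hypothesis OF : O \in faces G.
Hypothesis Ocover : face_verts O = [set: V].

Let I := interior_faces G O.

Lemma outer_dart v : exists2 a, adj G v a & (v, a) \in O.
Proof.
have : v \in face_verts O by rewrite Ocover inE.
case/imsetP=> -[x a] dO /= ->; exists a => //.
by rewrite -(mem_darts (x, a)); have [] := mem_faces OF dO.
Qed.

Lemma mem_interior d : d \in darts G -> (face_at G d \in I) = (d \notin O).
Proof.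
move=> dD; rewrite !inE face_at_faces // andbT; congr (~~ _).
apply/eqP/idP => [<-|dO]; first exact: face_at_self.
by have [] := mem_faces OF dO.
Qed.

Lemma interior_face_verts v : exists2 F, F \in I & v \in face_verts F.
Proof.
have [a _ vaO] := outer_dart v; have [b vb ba] := two_connected_degree v a.
exists (face_at G (v, b)); last by apply/imsetP; exists (v, b); rewrite ?face_at_self.
rewrite mem_interior ?mem_darts //; apply: contra ba => vbO.
by rewrite (face_visits_once OF vbO vaO).
Qed.

(** The darts out of a vertex lie, one outer dart excepted, in interior faces;
    going around the vertex from one side of the outer corner to the other
    passes between all of them through shared edges.  An edge has an interior
    face on at least one side, which links the faces around its two ends. *)
Lemma interior_connected (S : {set {set V * V}}) F0 : F0 \in S -> S \subset I ->
  (forall d, d \in darts G -> face_at G d \in I -> face_at G (rev_dart d) \in S ->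
     face_at G d \in S) -> S = I.
Proof.
move=> F0S SI clo; apply/eqP; rewrite eqEsubset SI; apply/subsetP => F FI.
pose st d := face_at G d \in S.
have st_rev d : d \in darts G -> d \notin O -> rev_dart d \notin O -> st (rev_dart d) = st d.
  move=> dD dO rO; have rD : rev_dart d \in darts G by rewrite rev_dart_darts.
  apply/idP/idP; first by apply: clo => //; rewrite mem_interior.
  by rewrite -{1}(rev_dartK d); apply: clo => //; rewrite mem_interior.
have next_out d : d \in darts G -> (next d \in O) = (d \in O).
  by move=> dD; rewrite face_mem_next.
have st_next d : st (next d) = st d by rewrite /st face_at_next.
have st_rot v c : adj G v c -> (v, c) \notin O -> (v, Defs.rot G v c) \notin O ->
    st (v, Defs.rot G v c) = st (v, c).
  move=> vc vcO vrO; have cvD : (c, v) \in darts G by rewrite mem_darts /= adj_sym.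
  have cvO : (c, v) \notin O by rewrite -next_out.
  by rewrite -[LHS]/(st (next (c, v))) st_next -(st_rev (c, v)).
have st_vertex v c c' : adj G v c -> adj G v c' -> (v, c) \notin O ->
    (v, c') \notin O -> st (v, c) = st (v, c').
  have [a va vaO] := outer_dart v; set r := Defs.rot G v.
  have outE x : (v, x) \in O -> x = a by move=> vx; apply: face_visits_once OF vx vaO.
  (* Turn around [v] from the outer dart [a], stopping before it recurs. *)
  have main i : (forall j, (0 < j <= i.+1)%N -> (r ^+ j)%g a != a) ->
      st (v, (r ^+ i.+1)%g a) = st (v, r a).
    elim: i => [|i IH] ne; first by rewrite expg1.
    rewrite -IH; last by move=> j /andP[j0 ji]; apply: ne; rewrite j0 leqW.
    rewrite [in LHS]expgSr permM; apply: st_rot.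
    - exact: rotX_adj.
    - by apply/negP => /outE/eqP; apply/negP/ne; rewrite leqnSn.
    - rewrite -/r -permM -expgSr.
      by apply/negP => /outE/eqP; apply/negP/ne; rewrite leqnn.
  suff H x : adj G v x -> (v, x) \notin O -> st (v, x) = st (v, r a).
    by move=> vc vc' h h'; rewrite !H.
  move=> vx vxO; have xa : x != a by apply: contraNneq vxO => ->.
  have ex : exists m, x == (r ^+ m)%g a.
    by move: vx; rewrite -(rotP x va) => /porbitP[m ->]; exists m.
  case: (ex_minnP ex) => -[|m] /eqP xm mmin; first by rewrite xm expg0 perm1 eqxx in xa.
  rewrite xm; apply: main => j /andP[j0 jm]; apply/eqP => ja.
  have : x == (r ^+ (m.+1 - j))%g a.
    by rewrite xm -[X in (r ^+ X)%g](@subnKC j m.+1) // expgD permM ja.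
  by move/mmin; clear -j0; lia.
pose P x := forall c, adj G x c -> (x, c) \notin O -> st (x, c).
have allP x : P x.
  have F0I := subsetP SI _ F0S; have F0F : F0 \in faces G by move: F0I; rewrite !inE => /andP[].
  have /imsetP[[u c0] d0D F0E] := F0F; have uc0 : adj G u c0 by rewrite -(mem_darts (u, c0)).
  have Pu : P u.
    move=> c uc ucO; rewrite (st_vertex u c c0) //; first by rewrite /st -F0E.
    by rewrite -mem_interior // -F0E.
  have : connect [rel a b | [&& adj G a b, a \notin finset.set0 & b \notin finset.set0]] u x.
    by apply: planeG.1; rewrite inE.
  apply: connect_ind => // {x} x y /= /and3P[xy _ _] Px c yc ycO.
  have yx : adj G y x by rewrite adj_sym.
  have [xyO|xyO] := boolP ((x, y) \in O).
    have yxO := rev_dart_other_face OF xyO.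
    rewrite (st_vertex y c x) // -st_next; apply: Px; first exact: rot_adj.
    by rewrite -[_ \notin O]/(next (y, x) \notin O) next_out ?mem_darts.
  rewrite (st_vertex y c (Defs.rot G y x)) //.
  - by rewrite -[st _]/(st (next (x, y))) st_next; apply: Px.
  - exact: rot_adj.
  - by rewrite -[_ \notin O]/(next (x, y) \notin O) next_out ?mem_darts.
have FF : F \in faces G by move: FI; rewrite !inE => /andP[].
have /imsetP[[u c] dD FE] := FF; rewrite FE; apply: allP.
  by rewrite -(mem_darts (u, c)).
by rewrite -mem_interior // -FE.
Qed.

Variable k : nat.
Hypothesis k3 : (3 <= k)%N.
Hypothesis Icycle : forall F, F \in I -> bounded_by_cycle k F.

Lemma interior_face F : F \in I -> F \in faces G.
Proof. by rewrite inE => /andP[]. Qed.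

Lemma dart_edge_sub F d : F \in faces G -> d \in F -> dart_edge d \subset face_verts F.
Proof.
move=> FF dF; apply/subsetP => x /set2P[]->; apply/imsetP; first by exists d.
by exists (next d); rewrite ?face_mem_next.
Qed.

Lemma face_polygon F : F \in faces G -> polygon (face_verts F) [set dart_edge d | d in F].
Proof.
move=> FF; split=> [_ /imsetP[d dF ->]|v].
  split; first exact: dart_edge_sub.
  have [dD _] := mem_faces FF dF; rewrite cards2.
  by have := dart_neq_rev dD; case: (d) => x y; rewrite xpair_eqE andbC eq_sym andbb => ->.
have inj2 d d' : d \in F -> d' \in F -> d.2 = d'.2 -> d = d'.
  case: d d' => x y [x' y'] dF d'F /= E; rewrite -{}E in d'F *.
  have nF : next (x, y) \in F by rewrite face_mem_next.
  have n'F : next (x', y) \in F by rewrite face_mem_next.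
  apply: face_next_inj; congr pair; exact: face_visits_once FF nF n'F.
have inj1 d d' : d \in F -> d' \in F -> d.1 = d'.1 -> d = d'.
  case: d d' => x y [x' y'] dF d'F /= E; rewrite E in dF *.
  by rewrite (face_visits_once FF dF d'F).
have one (pr : V * V -> V) :
    (forall d d', d \in F -> d' \in F -> pr d = pr d' -> d = d') ->
    (#|[set dart_edge d | d in [set d in F | pr d == v]]| <= 1)%N.
  move=> inj; apply: leq_trans (leq_imset_card _ _) _.
  rewrite leqNgt; apply/negP => /card_gt1P[d [d' []]]; rewrite !inE.
  move=> /andP[dF /eqP dv] /andP[d'F /eqP d'v] /eqP; apply.
  by apply: inj => //; rewrite dv d'v.
apply: (leq_trans _ (leq_add (one fst inj1) (one snd inj2))).
apply: leq_trans (leq_card_setU _ _); apply/subset_leq_card/subsetP => a.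
rewrite !inE => /andP[/imsetP[d dF ->]]; rewrite !inE eq_sym (eq_sym v) => /orP[] vd.
  by rewrite imset_f // inE dF.
by rewrite orbC imset_f // inE dF.
Qed.

(** Counting darts face by face gives [2 |E| = |O| + k |I|], and the outer
    boundary has at least as many darts as there are vertices. *)
Lemma interior_euler : ((k - 2) * #|I| + 2 <= #|V|)%N.
Proof.
have [_ euler] := planeG.
have cO : (#|V| <= #|O|)%N by rewrite -cardsT -Ocover leq_imset_card.
have := card_darts; rewrite (card_partition faces_partition) (bigD1 O) //=.
rewrite (eq_bigr (fun=> k)); last first.
  move=> F /andP[FF FO]; have [] // := Icycle (F := F) _.
  by rewrite !inE FO.
rewrite sum_nat_const.
have -> : #|[pred F | (F \in faces G) && (F != O)]| = #|I|.
  by apply: eq_card => F; rewrite !inE andbC.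
have := cardsD1 O (faces G); rewrite OF -/I => cF.
have kI : (2 * #|I| <= #|I| * k)%N by rewrite mulnC leq_mul2l ltnW ?orbT.
move: kI cO euler; rewrite cF mulnBl (mulnC k) -[faces G :\ O]/I.
rewrite /= add1n; move: #|I| #|O| #|V| #|edges G| => i o n e.
by move: (i * k)%N => x; lia.
Qed.

Definition verts_of (S : {set {set V * V}}) : {set V} :=
  cover [set face_verts F | F in S].

Lemma verts_ofP (S : {set {set V * V}}) v :
  reflect (exists2 F, F \in S & v \in face_verts F) (v \in verts_of S).
Proof.
apply: (iffP bigcupP) => [[_ /imsetP[F FS ->] vF]|[F FS vF]]; first by exists F.
by exists (face_verts F) => //; apply: imset_f.
Qed.

Lemma verts_ofU1 F (S : {set {set V * V}}) : verts_of (F |: S) = face_verts F :|: verts_of S.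
Proof. by rewrite /verts_of imsetU1 /cover bigcup_setU big_set1. Qed.

Lemma verts_of_interior : verts_of I = [set: V].
Proof.
apply/setP => v; rewrite !inE; apply/verts_ofP.
by have [F FI vF] := interior_face_verts v; exists F.
Qed.

Lemma interior_extend (S : {set {set V * V}}) : S != finset.set0 -> S \proper I ->
  exists d, [/\ d \in darts G, face_at G d \in I, face_at G d \notin S &
                face_at G (rev_dart d) \in S].
Proof.
case/set0Pn=> F0 F0S /andP[SI IS].
have [ex|nex] := boolP [exists d, [&& d \in darts G, face_at G d \in I,
                  face_at G d \notin S & face_at G (rev_dart d) \in S]].
  by case/existsP: ex => d /and4P[]; exists d.
case/negP: IS; rewrite (interior_connected F0S SI) ?subxx // => d dD dI rS.
apply/negPn/negP => dS; case/negP: nex; apply/existsP; exists d.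
by rewrite dD dI dS rS.
Qed.

Lemma card_verts_of_extend (S : {set {set V * V}}) d :
  d \in darts G -> face_at G d \in I -> face_at G (rev_dart d) \in S -> S \subset I ->
  (#|verts_of (face_at G d |: S)| + 2 <= #|verts_of S| + k)%N /\
  dart_edge d \subset face_verts (face_at G d) :&: verts_of S.
Proof.
move=> dD dI rS SI.
have dsub : dart_edge d \subset face_verts (face_at G d) :&: verts_of S.
  rewrite subsetI dart_edge_sub ?face_at_self ?face_at_faces //=.
  rewrite -dart_edge_rev; apply: subset_trans (dart_edge_sub (F := face_at G (rev_dart d)) _ _) _.
  - by rewrite face_at_faces ?rev_dart_darts.
  - exact: face_at_self.
  - by apply/subsetP => v vr; apply/verts_ofP; exists (face_at G (rev_dart d)).
split=> //; have := subset_leq_card dsub; rewrite verts_ofU1.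
have := cardsUI (face_verts (face_at G d)) (verts_of S).
have [_ ->] := Icycle dI; have -> : #|dart_edge d| = 2%N.
  rewrite cards2; have := dart_neq_rev dD.
  by case: (d) => x y; rewrite xpair_eqE andbC eq_sym andbb => ->.
by clear; move: #|verts_of _| #|_ :&: _| #|_ :|: _| => a b c; lia.
Qed.

(** Adding the remaining faces one neighbour at a time, each with at most
    [k - 2] new vertices, must reach the total required by Euler's formula. *)
Lemma card_verts_of (S : {set {set V * V}}) : S != finset.set0 -> S \subset I ->
  ((k - 2) * #|S| + 2 <= #|verts_of S|)%N.
Proof.
move: {2}(#|I| - #|S|)%N (leqnn (#|I| - #|S|)) => m.
elim: m S => [|m IH] S mS S0 SI.
  have -> : S = I by apply/eqP; rewrite eqEcard SI; move: mS; clear; lia.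
  by rewrite verts_of_interior cardsT interior_euler.
have [->|SneI] := eqVneq S I; first by rewrite verts_of_interior cardsT interior_euler.
have Sp : S \proper I by rewrite properEneq SneI.
have [d [dD dI dS rS]] := interior_extend S0 Sp.
have [cS _] := card_verts_of_extend dD dI rS SI.
have c1 : #|face_at G d |: S| = #|S|.+1 by rewrite cardsU1 dS.
have lt : (#|S| < #|I|)%N by apply: proper_card.
have : ((k - 2) * #|S|.+1 + 2 <= #|verts_of (face_at G d |: S)|)%N.
  rewrite -c1; apply: IH; last by rewrite subUset sub1set dI.
    by rewrite c1; move: mS lt; clear; lia.
  by rewrite -card_gt0 c1.
move: cS k3; rewrite mulnS; clear.
by move: #|verts_of S| #|verts_of _| ((k - 2) * _)%N => a b x; lia.
Qed.

(** The upper bound on the number of vertices from the attachments meets the lower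
    bound of [card_verts_of], so the vertices shared with earlier faces are just
    the two ends of a common edge.  The edges with one side in [S] remain free. *)
Lemma interior_accretion_card m : (0 < m <= #|I|)%N ->
  exists (S : {set {set V * V}}) (B : {set {set V}}),
  [/\ S \subset I, #|S| = m, #|verts_of S| = ((k - 2) * m + 2)%N,
      accretion k [set face_verts F | F in S] B &
      forall d, d \in darts G -> face_at G (rev_dart d) \in S ->
        face_at G d \notin S -> dart_edge d \in B].
Proof.
elim: m => [//|[_ /andP[_ I0]|m IH /andP[_ mI]]].
  have /card_gt0P[F FI] := I0; have FF := interior_face FI.
  exists [set F], [set dart_edge d | d in F].
  rewrite sub1set FI cards1 /verts_of imset_set1 /cover big_set1.
  have [_ Fk] := Icycle FI.
  split=> //; first by rewrite Fk muln1; move: k3; clear; lia.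
    by constructor => //; apply: face_polygon.
  move=> d dD /set1P rF _; rewrite -dart_edge_rev imset_f // -rF.
  exact: face_at_self.
have [|S [B [SI Sm Sv acc bd]]] := IH; first by rewrite ltn0Sn ltnW.
have S0 : S != finset.set0 by rewrite -card_gt0 Sm.
have Sp : S \proper I by rewrite properEcard SI Sm.
have [d [dD dI dS rS]] := interior_extend S0 Sp.
have [cS dsub] := card_verts_of_extend dD dI rS SI.
set F := face_at G d in dI dS cS dsub *; have FF := interior_face dI.
have SI' : F |: S \subset I by rewrite subUset sub1set dI.
have S'm : #|F |: S| = m.+2 by rewrite cardsU1 dS Sm add1n.
have lower : ((k - 2) * m.+2 + 2 <= #|verts_of (F |: S)|)%N.
  by rewrite -S'm card_verts_of // -card_gt0 S'm.
have dF : d \in F by apply: face_at_self.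
have meet : face_verts F :&: verts_of S = dart_edge d.
  apply/esym/eqP; rewrite eqEcard dsub.
  have -> : #|dart_edge d| = 2%N by have [/(_ _ (imset_f _ dF))[]] := face_polygon FF.
  have := cardsUI (face_verts F) (verts_of S); rewrite -verts_ofU1 Sv.
  have [_ ->] := Icycle dI; move: lower k3; rewrite !mulnS; clear.
  by move: #|verts_of _| #|_ :&: _| ((k - 2) * m)%N => U X x; lia.
exists (F |: S), ((B :|: [set dart_edge d | d in F]) :\ [set d.1; d.2]).
split=> //.
- apply/eqP; rewrite eqn_leq lower andbT; move: cS k3; rewrite Sv !mulnS; clear.
  by move: #|verts_of _| ((k - 2) * m)%N => U x; lia.
- rewrite imsetU1; apply: accretion_step => //.
  + by have [] := Icycle dI.
  + exact: face_polygon.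
  + exact: bd.
  + exact: imset_f.
move=> d' d'D /setU1P r'S; rewrite inE negb_or => /andP[d'F d'S].
rewrite !inE; apply/andP; split.
  apply/eqP => E; have [d'd|d'd] := dart_edge_eq dD d'D (esym E).
    by rewrite d'd -/F inE eqxx in d'F.
  by rewrite d'd rS in d'S.
case: r'S => [rF|rS']; last by rewrite bd.
by rewrite orbC -dart_edge_rev imset_f // -rF face_at_self.
Qed.

Lemma card_interior_gt0 : (0 < #|I|)%N.
Proof.
have /card_gt0P[v _] : (0 < #|V|)%N by apply: leq_ltn_trans G2.1.
by have [F FI _] := interior_face_verts v; apply/card_gt0P; exists F.
Qed.

Lemma face_hypergraph_accretion : exists B, accretion k (face_hypergraph G O) B.
Proof.
have [|S [B [SI SE _ acc _]]] := @interior_accretion_card #|I|.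
  by rewrite card_interior_gt0 leqnn.
have SeI : S = I by apply/eqP; rewrite eqEcard SI SE leqnn.
by exists B; rewrite SeI in acc.
Qed.

End Rotation.

Lemma k_angulation_accretion (V : finType) (k : nat) (H : {set {set V}}) :
  (3 <= k)%N -> k_angulation_hypergraph k H ->
  (exists B, accretion k H B) /\ ((k - 2) * #|H| + 2 <= #|V|)%N.
Proof.
move=> k3 [G [Out [ [G2 [pl OF Oc] Ic] ->] ] ]; split.
  exact: (face_hypergraph_accretion pl G2 OF Oc k3 Ic).
apply: leq_trans (interior_euler pl OF Oc k3 Ic).
by rewrite leq_add2r leq_mul2l leq_imset_card orbT.
Qed.

(** * The fan *)
Section NeighbourLists.
Variables (V : finType) (nbs : V -> seq V).
Hypothesis nbs_uniq : forall v, uniq (nbs v).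
Hypothesis nbs_sym : forall u v, (v \in nbs u) = (u \in nbs v).
Hypothesis nbs_irrefl : forall v, v \notin nbs v.

Let nadj : rel V := fun u v => v \in nbs u.
Let nrot v : {perm V} := perm (can_inj (prev_next (nbs_uniq v))).

Lemma nadj_irrefl : irreflexive nadj.
Proof. by move=> v; apply/negbTE/nbs_irrefl. Qed.

Lemma nrotP u v w : nadj u v -> (w \in porbit (nrot u) v) = nadj u w.
Proof.
move=> uv; rewrite /nadj -(fconnect_cycle (cycle_next (nbs_uniq u)) uv).
have it i : (nrot u ^+ i)%g v = iter i (path.next (nbs u)) v.
  by rewrite permX; elim: i => //= i ->; rewrite permE.
apply/porbitP/idP => [[i ->]|]; first by rewrite it fconnect_iter.
by move/iter_findex <-; exists (findex (path.next (nbs u)) v w); rewrite it.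
Qed.

(** Lists of neighbours, read cyclically, define a rotation system. *)
Definition neighbour_list_graph : embedded_graph V :=
  EmbeddedGraph nbs_sym nadj_irrefl nrotP.

Lemma rot_neighbour_list u v :
  Defs.rot neighbour_list_graph u v = path.next (nbs u) v.
Proof. by rewrite /= permE. Qed.

End NeighbourLists.

(** The vertices are [0, ..., N] in the order of the outer cycle.  Vertex 0 is
    the hub, joined to [1 + m j] for [j <= f]; the face number [j] consists of
    the hub and the [m + 1] vertices from [1 + m j] to [1 + m (j + 1)].  Listing
    the neighbours of each vertex in increasing order gives the rotation of
    the drawing with the vertices on a circle. *)
Section Fan.
Variables (m f : nat).
Hypotheses (m_gt0 : (0 < m)%N) (f_gt0 : (0 < f)%N).

Let N := (m * f).+1.
Let W := 'I_(m * f).+2.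

Let spoke j := (m * j).+1.

(** The first and the last spoke are sides of the outer cycle; writing 0 only as
    the hub, not as the predecessor of 1 or the successor of [N], keeps the list
    free of repetitions. *)
Definition fan_list (u : nat) : seq nat :=
  if u == 0%N then [seq (m * j).+1 | j <- iota 0 f.+1] else
  (if (m %| u.-1)%N then [:: 0%N] else [::]) ++
  (if (1 < u)%N then [:: u.-1] else [::]) ++
  (if (u < N)%N then [:: u.+1] else [::]).

Lemma spokeP v : (v <= N)%N ->
  (v \in [seq (m * j).+1 | j <- iota 0 f.+1]) = (0 < v)%N && (m %| v.-1)%N.
Proof.
move=> vN; apply/mapP/andP => [[j _ ->]|[v0 /dvdnP[j vj]]].
  by rewrite /= dvdn_mulr.
exists j; last by rewrite mulnC -vj prednK.
rewrite mem_iota leq0n add0n /= ltnS -(leq_pmul2l m_gt0) mulnC -vj.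
by rewrite -ltnS prednK.
Qed.

Lemma mem_fan_list u v : (u <= N)%N -> (v <= N)%N ->
  (v \in fan_list u) = [|| [&& u == 0, 0 < v & m %| v.-1],
    [&& v == 0, 0 < u & m %| u.-1] | [&& 0 < u, 0 < v & (v == u.+1) || (u == v.+1)]]%N.
Proof.
move=> uN vN; rewrite /fan_list; case: (eqVneq u 0%N) => [->|u0].
  by rewrite spokeP //= !andbF /= !orbF.
rewrite -lt0n in u0; rewrite u0 /= !mem_cat.
have -> : (v \in if (m %| u.-1)%N then [:: 0%N] else [::]) = (v == 0%N) && (m %| u.-1)%N.
  by case: ifP => _; rewrite ?inE ?andbT ?andbF.
have -> : (v \in if (1 < u)%N then [:: u.-1] else [::]) = (0 < v)%N && (u == v.+1).
  by case: ifP => h; rewrite ?inE ?in_nil; lia.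
have -> : (v \in if (u < N)%N then [:: u.+1] else [::]) = (v == u.+1).
  by case: ifP => h; rewrite ?inE ?in_nil //; lia.
by case: (_ && (m %| _)%N) => //=; lia.
Qed.

Lemma fan_list_le u v : (u <= N)%N -> v \in fan_list u -> (v <= N)%N.
Proof.
move=> uN; rewrite /fan_list; case: eqP => _.
  by case/mapP => j; rewrite mem_iota /N => /andP[_ jf] ->; rewrite ltnS leq_mul2l; lia.
rewrite !mem_cat => /orP[|/orP[]]; case: ifP => //; rewrite inE.
- by move=> _ /eqP ->.
- by move=> _ /eqP ->; lia.
- by move=> h /eqP ->.
Qed.

Lemma fan_list_uniq u : uniq (fan_list u).
Proof.
rewrite /fan_list; case: (eqVneq u 0%N) => [_|u0].
  by rewrite map_inj_uniq ?iota_uniq // => i j [] /eqP; rewrite eqn_pmul2l // => /eqP.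
by case: ifP => _; case: ifP => h; case: ifP => h' //=; rewrite ?inE; lia.
Qed.

Definition fan_nbs (u : W) : seq W := [seq inord v | v <- fan_list u].

Lemma val_fan_nbs u : [seq val v | v <- fan_nbs u] = fan_list u.
Proof.
rewrite -map_comp -[RHS]map_id; apply/eq_in_map => v vu /=.
by rewrite inordK // ltnS; apply: fan_list_le vu; rewrite -ltnS ltn_ord.
Qed.

Lemma mem_fan_nbs u v : (v \in fan_nbs u) = (val v \in fan_list u).
Proof. by rewrite -val_fan_nbs mem_map //; apply: val_inj. Qed.

Lemma fan_nbs_uniq u : uniq (fan_nbs u).
Proof. by rewrite -(map_inj_uniq val_inj) val_fan_nbs fan_list_uniq. Qed.

Lemma leN (u : W) : (u <= N)%N. Proof. by rewrite -ltnS ltn_ord. Qed.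

Lemma fan_nbs_sym u v : (v \in fan_nbs u) = (u \in fan_nbs v).
Proof.
rewrite !mem_fan_nbs !mem_fan_list ?leN // orbCA; congr [|| _, _ | _].
by rewrite andbCA orbC.
Qed.

Lemma fan_nbs_irrefl v : v \notin fan_nbs v.
Proof. 
rewrite mem_fan_nbs mem_fan_list ?leN //=; move: (nat_of_ord v) => i.
by case: i => [|i] /=; rewrite ?andbF ?(ltn_eqF (ltnSn _)).
Qed.

Definition fan : embedded_graph W :=
  neighbour_list_graph fan_nbs_uniq fan_nbs_sym fan_nbs_irrefl.

Lemma fan_adj (u v : W) : adj fan u v = [|| [&& val u == 0, 0 < v & m %| v.-1],
    [&& val v == 0, 0 < u & m %| u.-1] |
    [&& 0 < u, 0 < v & (val v == u.+1) || (val u == v.+1)]]%N.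
Proof. by rewrite -mem_fan_list ?leN // -mem_fan_nbs. Qed.

Lemma fan_rot (u v w : W) :
  path.next (fan_list u) v = val w -> Defs.rot fan u v = w.
Proof.
rewrite -val_fan_nbs (next_map (@val_inj _ _ W) (fan_nbs_uniq u) v).
by move/val_inj => <-; rewrite rot_neighbour_list.
Qed.

Lemma next_hub j : (j <= f)%N ->
  path.next (fan_list 0) (m * j).+1 = if (j < f)%N then (m * j.+1).+1 else 1%N.
Proof.
move=> jf; rewrite /fan_list eqxx.
have inj : injective (fun j => (m * j).+1).
  by move=> a b [] /eqP; rewrite eqn_pmul2l // => /eqP.
rewrite (next_map inj (iota_uniq _ _)) next_nth mem_iota ltnS jf /=.
have -> : (if 0 == j then 0 else (index j (iota 1 f)).+1)%N = j.
  rewrite -[LHS]/(index j (iota 0 f.+1)).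
  have := @index_uniq _ 0%N j (iota 0 f.+1); rewrite size_iota iota_uniq nth_iota //.
  by apply.
case: ltnP => jf'; first by rewrite nth_iota.
by rewrite nth_default ?size_iota // muln0.
Qed.

Lemma next_up u : (0 < u < N)%N -> path.next (fan_list u) u.-1 = u.+1.
Proof.
case/andP=> u0 uN; rewrite /fan_list (gtn_eqF u0) uN.
case: ltnP => u1; last first.
  have -> : u = 1%N by lia.
  by rewrite /= dvdn0.
by case: ifP => _ /=; rewrite ?eqxx //; case: eqP => //; lia.
Qed.

Lemma next_last : path.next (fan_list N) N.-1 = 0%N.
Proof.
rewrite /fan_list /N /= ltnn dvdn_mulr //= ltnS muln_gt0 m_gt0 f_gt0 /=.
by rewrite eqxx; case: eqP => // ->.
Qed.

Lemma next_down u : (0 < u < N)%N ->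
  path.next (fan_list u) u.+1 = if (m %| u.-1)%N then 0%N else u.-1.
Proof.
case/andP=> u0 uN; rewrite /fan_list (gtn_eqF u0) uN.
case: ltnP => u1; last first.
  have -> : u = 1%N by lia.
  by rewrite /= dvdn0.
have h : (u.+1 == u.-1) = false by lia.
by case: ifP => _ /=; rewrite h eqxx.
Qed.

Lemma next_spoke u : (1 < u)%N -> (m %| u.-1)%N -> path.next (fan_list u) 0 = u.-1.
Proof. by move=> u1 mu; rewrite /fan_list gtn_eqF ?mu ?u1 //; lia. Qed.

Let o (i : nat) : W := inord i.

Lemma oK i : (i <= N)%N -> o i = i :> nat.
Proof. by move=> iN; rewrite inordK. Qed.

Lemma face_next_fan (a b c : nat) : (a <= N)%N -> (b <= N)%N -> (c <= N)%N ->
  path.next (fan_list b) a = c -> face_next fan (o a, o b) = (o b, o c).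
Proof.
move=> aN bN cN E; rewrite /face_next /=; congr pair.
by apply: fan_rot; rewrite /= !oK.
Qed.

Lemma spoke_le j : (j <= f)%N -> (spoke j <= N)%N.
Proof. by move=> jf; rewrite /spoke /N ltnS leq_mul2l jf orbT. Qed.

Definition fan_outer : {set W * W} :=
  [set d : W * W | (val d.2 == (val d.1).+1) || (val d.1 == N) && (val d.2 == 0%N)].

Definition fan_inner (j : nat) : {set W * W} :=
  [set d : W * W | [|| (val d.1 == 0%N) && (val d.2 == spoke j.+1),
               (val d.1 == spoke j) && (val d.2 == 0%N) |
               [&& val d.1 == (val d.2).+1, spoke j <= val d.2 & val d.1 <= spoke j.+1]]]%N.

Lemma pair_o (d : W * W) a b : val d.1 = a -> val d.2 = b -> d = (o a, o b).
Proof. by case: d => x y /= <- <-; rewrite /o !inord_val. Qed.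

Lemma face_outer : face_at fan (o 0, o 1) = fan_outer.
Proof.
have N1 : (1 <= N)%N by [].
have up i : (i.+2 <= N)%N -> face_next fan (o i, o i.+1) = (o i.+1, o i.+2).
  by move=> iN; apply: face_next_fan; rewrite ?next_up //; lia.
have last1 : face_next fan (o N.-1, o N) = (o N, o 0).
  by apply: face_next_fan; rewrite ?next_last //.
have last2 : face_next fan (o N, o 0) = (o 0, o 1).
  by apply: face_next_fan => //; rewrite next_hub // ltnn.
apply/setP => d; rewrite inE; apply/idP/idP.
  apply: (@connect_ind _ _ (fun d => d \in fan_outer)).
    by rewrite inE /= !oK.
  move=> x _ /eqP <-; rewrite [x \in _]inE => /orP[/eqP E|/andP[/eqP E1 /eqP E2]].
    have xN : ((val x.1).+1 <= N)%N by rewrite -E leN.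
    rewrite (pair_o (erefl (val x.1)) E).
    have [x2|x2] := ltnP (val x.1).+1 N.
      by rewrite up // inE /= !oK ?eqxx // ltnW.
    have {}x2 : N = (val x.1).+1 by apply/eqP; rewrite eqn_leq xN x2.
    rewrite -x2 (_ : val x.1 = N.-1); last by rewrite x2.
    by rewrite last1 inE /= !oK // !eqxx orbT.
  by rewrite (pair_o E1 E2) last2 inE /= !oK.
have reach i : (i < N)%N -> fconnect (face_next fan) (o 0, o 1) (o i, o i.+1).
  elim: i => [_|i IH iN]; first exact: connect0.
  by apply: connect_trans (IH (ltnW iN)) _; rewrite -up // fconnect1.
rewrite inE => /orP[/eqP E|/andP[/eqP E1 /eqP E2]].
  by rewrite (pair_o (erefl (val d.1)) E) reach // -E leN.
rewrite (pair_o E1 E2); apply: connect_trans (reach N.-1 _) _ => //.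
by rewrite -last1; apply: (fconnect1 _ (o N.-1, o N)).
Qed.

(** The walk goes from the hub out along one spoke, down the outer cycle to the
    previous spoke and back to the hub. *)
Lemma face_inner j : (j < f)%N ->
  face_at fan (o 0, o (spoke j.+1)) = fan_inner j.
Proof.
move=> jf; have sj : (spoke j < spoke j.+1)%N by rewrite /spoke mulnS; lia.
have sN : (spoke j.+1 <= N)%N by apply: spoke_le.
have j0 : (0 < spoke j)%N by [].
have dj i : (m %| (spoke i).-1)%N by rewrite dvdn_mulr.
have close_seq : path.next (fan_list 0) (spoke j) = spoke j.+1.
  by rewrite next_hub ?jf // ltnW.
(* No spoke ends strictly between two consecutive ones. *)
have between i : (spoke j < i < spoke j.+1)%N -> (m %| i.-1)%N = false.
  case: i => [|i] //; rewrite /spoke !ltnS => /andP[ji ij].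
  apply/negP => /dvdnP[q iq]; move: ji ij.
  by rewrite /= in iq; rewrite iq (mulnC q) !ltn_pmul2l // => ji; rewrite ltnS leqNgt ji.
move: close_seq (dj j) (dj j.+1) between.
rewrite /fan_inner -/(spoke j) -/(spoke j.+1).
move: (spoke j) (spoke j.+1) j0 sj sN => p q p0 pq qN close_seq mp mq between.
have start : face_next fan (o 0, o q) = (o q, o q.-1).
  by apply: face_next_fan; rewrite ?next_spoke //; lia.
have down i : (p < i < q)%N -> face_next fan (o i.+1, o i) = (o i, o i.-1).
  by move=> ij; apply: face_next_fan; rewrite ?next_down ?between //; lia.
have turn : face_next fan (o p.+1, o p) = (o p, o 0).
  by apply: face_next_fan; rewrite ?next_down ?mp //; lia.
have close : face_next fan (o p, o 0) = (o 0, o q).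
  by apply: face_next_fan => //; lia.
set S := [set d | _].
apply/setP => d; rewrite inE; apply/idP/idP.
  apply: (@connect_ind _ _ (fun d => d \in S)).
    by rewrite inE /= !oK ?eqxx.
  move=> x _ /eqP <-; rewrite [x \in _]inE => /or3P[/andP[/eqP E1 /eqP E2]|/andP[/eqP E1 /eqP E2]|/and3P[/eqP E1 E2 E3]].
  - by rewrite (pair_o E1 E2) start inE /= !oK; lia.
  - by rewrite (pair_o E1 E2) close inE /= !oK; lia.
  - rewrite (pair_o E1 (erefl _)); move: (val x.2) E1 E2 E3 => b -> pb bq.
    have [x2|x2] := ltnP p b; first by rewrite down ?inE /= ?oK; lia.
    have -> : b = p by lia.
    by rewrite turn inE /= !oK; lia.
have reach i : (i < q - p)%N ->
    fconnect (face_next fan) (o 0, o q) (o (q - i), o (q - i).-1).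
  elim: i => [_|i IH iN].
    by rewrite subn0 -start fconnect1.
  apply: connect_trans (IH _) _; first by lia.
  suff <- : face_next fan (o (q - i), o (q - i).-1) = (o (q - i.+1), o (q - i.+1).-1).
    exact: fconnect1.
  have -> : (q - i.+1 = (q - i).-1)%N by lia.
  by rewrite -(down (q - i).-1%N) ?prednK //; lia.
rewrite inE => /or3P[/andP[/eqP E1 /eqP E2]|/andP[/eqP E1 /eqP E2]|/and3P[/eqP E1 E2 E3]].
- by rewrite (pair_o E1 E2) connect0.
- rewrite (pair_o E1 E2); have := reach (q - p).-1.
  have -> : (q - (q - p).-1 = p.+1)%N by lia.
  move=> h; apply: connect_trans (h _) _; first by lia.
  by rewrite /= -turn fconnect1.
- rewrite (pair_o E1 (erefl _)); move: (val d.2) E1 E2 E3 => b -> pb bq.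
  have E : (q - (q - b.+1) = b.+1)%N by lia.
  by have := reach (q - b.+1)%N; rewrite E; apply; lia.
Qed.

Lemma fan_dart_cover d : d \in darts fan ->
  d \in fan_outer \/ exists j : 'I_f, d \in fan_inner j.
Proof.
rewrite mem_darts fan_adj => /or3P[/and3P[/eqP d1 d2]|/and3P[/eqP d2 d1]|/and3P[d1 d2]].
- case/dvdnP => [[|i]] E.
    left; rewrite inE d1 (_ : val d.2 = 1%N) //.
    by move: d2 E; rewrite mul0n /=; case: (nat_of_ord d.2) => [|[|]].
  have E' : val d.2 = spoke i.+1 by rewrite -[LHS](prednK d2) E /spoke (mulnC m i.+1).
  have i_lt : (i < f)%N.
    have := leN d.2; rewrite -[nat_of_ord _]/(val d.2) E'.
    by rewrite /spoke /N ltnS leq_pmul2l.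
  by right; exists (Ordinal i_lt); rewrite inE d1 E' !eqxx.
- case/dvdnP => i E; have E' : val d.1 = spoke i.
    by rewrite -[LHS](prednK d1) E /spoke (mulnC m i).
  have := leN d.1; rewrite -[nat_of_ord _]/(val d.1) E' /spoke /N ltnS leq_pmul2l //.
  rewrite leq_eqVlt => /orP[/eqP i_f|i_lt].
    by left; rewrite inE d2 E' /spoke i_f !eqxx orbT.
  by right; exists (Ordinal i_lt); rewrite inE d2 E' !eqxx orbT.
- case/orP=> [/eqP E|/eqP E]; first by left; rewrite inE E eqxx.
  right; have b_lt : ((val d.2).-1 < m * f)%N.
    by have := leN d.1; rewrite -[nat_of_ord d.1]/(val d.1) E /N /= ltnS; move: d2; rewrite /=; lia.
  have j_lt : ((val d.2).-1 %/ m < f)%N by rewrite ltn_divLR // (mulnC f m).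
  exists (Ordinal j_lt); rewrite inE E eqxx /= /spoke.
  have := divn_eq (val d.2).-1 m; have := ltn_pmod (val d.2).-1 m_gt0.
  rewrite mulnS (mulnC _ m); move: d2 => /=.
  move: (nat_of_ord d.2) => b b0; move: (b.-1 %/ m)%N (b.-1 %% m)%N => q r.
  by move: (m * q)%N b0; clear; lia.
Qed.

Lemma fan_hub_dart i : (i <= f)%N -> (o 0, o (spoke i)) \in darts fan.
Proof. by move=> i_f; rewrite mem_darts fan_adj /= !oK ?spoke_le //= dvdn_mulr. Qed.

Lemma fan_faces : faces fan = fan_outer |: [set fan_inner (val j) | j in 'I_f].
Proof.
apply/setP => F; rewrite in_setU1; apply/imsetP/orP => [[d dD ->]|[/eqP ->|/imsetP[j _ ->]]].
- have [dO|[j dj]] := fan_dart_cover dD.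
    by left; rewrite -face_outer; apply/eqP/face_at_eq; rewrite face_outer.
  right; apply/imsetP; exists j => //; rewrite -face_inner ?ltn_ord //.
  by apply: face_at_eq; rewrite face_inner ?ltn_ord.
- exists (o 0, o 1); last by rewrite face_outer.
  by have := @fan_hub_dart 0 isT; rewrite /spoke muln0.
- exists (o 0, o (spoke j.+1)); last by rewrite face_inner ?ltn_ord.
  by apply: fan_hub_dart; apply: ltn_ord.
Qed.

Lemma card_ord_interval n a b : (b <= n)%N -> #|[set v : 'I_n | (a <= v < b)%N]| = (b - a)%N.
Proof.
move=> bn; rewrite -sum1dep_card -(big_mkord (fun i => (a <= i < b)%N) (fun=> 1%N)).
have [ab|ba] := leqP a b; last first.
  by rewrite big_pred0 => [|i]; lia.
rewrite -(big_nat_widen 0 b n (fun i => (a <= i)%N) (fun=> 1%N)) //.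
by rewrite -(big_nat_widenl a 0 b xpredT (fun=> 1%N)) // sum_nat_const_nat muln1.
Qed.

Lemma fan_outer_verts : face_verts fan_outer = [set: W].
Proof.
apply/setP => v; rewrite inE; apply/imsetP.
have [vN|vN] := eqVneq (val v) N.
  by exists (v, o 0) => //; rewrite inE /= oK // vN !eqxx orbT.
have lt : (v < N)%N by rewrite ltn_neqAle vN leN.
by exists (v, o v.+1) => //; rewrite inE /= oK ?eqxx.
Qed.

Lemma card_fan_outer : #|fan_outer| = N.+1.
Proof.
transitivity #|face_verts fan_outer|; last by rewrite fan_outer_verts cardsT card_ord.
apply/esym/card_in_imset => -[x y] [x' y']; rewrite !inE /= => h h' E.
rewrite -E in h' *; congr pair; apply: val_inj => /=.
by have := leN y; have := leN y'; have := leN x; move: h h'; clear; lia.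
Qed.

Lemma fan_inner_verts j : (j < f)%N ->
  face_verts (fan_inner j) = o 0 |: [set v : W | (spoke j <= v < (spoke j.+1).+1)%N].
Proof.
move=> jf; have sj : (spoke j < spoke j.+1)%N by rewrite /spoke mulnS; lia.
have sN : (spoke j.+1 <= N)%N by apply: spoke_le.
have j0 : (0 < spoke j)%N by [].
apply/setP => v; rewrite !inE; apply/imsetP/orP.
  case=> -[x y]; rewrite !inE /= => h ->; rewrite -val_eqE /= oK //.
  by move: (nat_of_ord x) (nat_of_ord y) (spoke j) (spoke j.+1) h sj j0; clear; lia.
case=> [/eqP ->|/andP[pv vq]].
  by exists (o 0, o (spoke j.+1)) => //; rewrite inE /= !oK // !eqxx.
have [vp|vp] := eqVneq (val v) (spoke j).
  by exists (v, o 0) => //; rewrite inE /= !oK // -[nat_of_ord v]/(val v) vp !eqxx orbT.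
exists (v, o v.-1) => //; rewrite inE /= oK ?(leq_trans (leq_pred v)) ?leN //.
move: vp pv vq => /=; move: (nat_of_ord v) (spoke j) (spoke j.+1) sj j0.
by clear; lia.
Qed.

Lemma card_fan_inner_verts j : (j < f)%N -> #|face_verts (fan_inner j)| = m.+2.
Proof.
move=> jf; rewrite fan_inner_verts // cardsU1 inE card_ord_interval ?oK //=.
  by rewrite /spoke mulnS; lia.
by rewrite ltnS spoke_le.
Qed.

Lemma card_fan_inner j : (j < f)%N -> #|fan_inner j| = m.+2.
Proof.
move=> jf; rewrite -(card_fan_inner_verts jf).
have sj : (spoke j < spoke j.+1)%N by rewrite /spoke mulnS; lia.
have j0 : (0 < spoke j)%N by [].
apply/esym/card_in_imset => -[x y] [x' y']; rewrite !inE /= => h h' E.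
rewrite -E in h' *; congr pair; apply: val_inj => /=.
move: h h' sj j0; move: (nat_of_ord x) (nat_of_ord y) (nat_of_ord y') (spoke j) (spoke j.+1).
by clear; lia.
Qed.

Lemma fan_hub_inner i j : (i < f)%N ->
  ((o 0, o (spoke i.+1)) \in fan_inner j) = (i == j).
Proof.
move=> i_f; rewrite inE /= !oK ?spoke_le //.
rewrite orbC /=; apply/eqP/eqP => [[]/eqP|->//].
by rewrite eqn_pmul2l // => /eqP [].
Qed.

Lemma fan_inner_inj : injective (fun j : 'I_f => fan_inner (val j)).
Proof.
move=> i j E; apply/val_inj/eqP; rewrite -(@fan_hub_inner (val i)) ?ltn_ord //.
by rewrite -E fan_hub_inner ?ltn_ord.
Qed.

Lemma fan_outer_notin : fan_outer \notin [set fan_inner (val j) | j in 'I_f].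
Proof.
apply/imsetP => -[j _ E]; have := @fan_hub_inner j j (ltn_ord j).
rewrite eqxx -E inE /= !oK ?spoke_le ?ltn_ord // eqSS -[0%N](muln0 m) eqn_pmul2l //.
by rewrite muln0 /= => ?.
Qed.

Lemma fan_interior : interior_faces fan fan_outer = [set fan_inner (val j) | j in 'I_f].
Proof. by rewrite /interior_faces fan_faces setU1K // fan_outer_notin. Qed.

Lemma fan_path (X : {set W}) a b : (a <= b)%N -> (b <= N)%N ->
  (forall i, (a <= i <= b)%N -> o i \notin X) ->
  connect [rel a b | [&& adj fan a b, a \notin X & b \notin X]] (o a) (o b).
Proof.
move=> ab bN; rewrite -(subnKC ab) in bN *; move: (b - a)%N bN => d.
elim: d => [|d IH] bN hX; first by rewrite addn0 connect0.
apply: connect_trans (IH _ _) _; first by lia.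
  by move=> i id; apply: hX; lia.
apply: connect1; apply/and3P; split; try (by apply: hX; lia).
rewrite fan_adj /= !oK ?addnS //; try lia.
by case: (posnP (a + d)) => [->|_]; rewrite /= ?dvdn0 ?eqxx ?orbT.
Qed.

(** Two vertices are joined by an arc of the outer cycle that avoids the removed
    vertex. *)
Lemma fan_two_connected : two_connected fan.
Proof.
split; first by rewrite card_ord /= !ltnS muln_gt0 m_gt0 f_gt0.
move=> X X1 u w uX wX.
set e := [rel a b | _].
have esym : connect_sym e.
  apply: sym_connect_sym => x y /=.
  by congr (_ && _); [exact: fan_nbs_sym|exact: andbC].
wlog uw : u w uX wX / (u <= w)%N.
  by move=> hw; case/orP: (leq_total u w) => h; [|rewrite esym]; apply: hw.
have oE (x : W) : o x = x by rewrite /o inord_val.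
have X_uniq x y : x \in X -> y \in X -> x = y.
  by move=> xX yX; apply/eqP/negPn/negP => xy; move: X1; rewrite ltnS leqNgt => /negP; apply;
    apply/card_gt1P; exists x, y.
have [/existsP[x /and3P[xX ux xw]]|none] := boolP [exists x, [&& x \in X, u < x & x < w]%N].
  have notX i : (i <= N)%N -> i != x -> o i \notin X.
    move=> iN; apply: contra => iX; have := X_uniq _ _ iX xX.
    by move/(congr1 val); rewrite /= oK // => ->.
  apply: (@connect_trans _ _ (o 0)).
    rewrite esym -(oE u); apply: fan_path; rewrite ?leN // => i iu.
    by apply: notX; [have := leN u; lia|lia].
  apply: (@connect_trans _ _ (o N)).
    apply: connect1; apply/and3P; split; last 2 first.
    - by apply: notX => //; lia.
    - by apply: notX => //; have := leN w; lia.
    - by rewrite fan_adj /= !oK //= dvdn_mulr.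
  rewrite esym -(oE w); apply: fan_path; rewrite ?leN // => i iw.
  by apply: notX; lia.
rewrite -(oE u) -(oE w); apply: fan_path; rewrite ?leN // => i /andP[ui iw].
have iN : (i <= N)%N by have := leN w; lia.
have [iu|iu] := eqVneq i u; first by rewrite iu oE.
have [iw'|iw'] := eqVneq i w; first by rewrite iw' oE.
apply: contra none => iX; apply/existsP; exists (o i); rewrite iX /= oK //.
by lia.
Qed.

Lemma fan_plane : plane fan.
Proof.
split; first by apply: fan_two_connected.2; rewrite cards0.
have := card_darts fan; rewrite (card_partition (faces_partition fan)).
rewrite fan_faces big_setU1 ?fan_outer_notin //= card_fan_outer.
rewrite big_imset /=; last by move=> i j _ _; apply: (@fan_inner_inj i j).
rewrite (eq_bigr (fun=> m.+2)); last by move=> j _; rewrite card_fan_inner ?ltn_ord.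
rewrite sum_nat_const cardsU1 fan_outer_notin (card_imset _ fan_inner_inj).
move: #|edges fan| => e; rewrite !card_ord /N !mulnS (mulnC f m) /=.
by move: (m * f)%N => x; clear; lia.
Qed.

Lemma fan_k_angulation : k_angulation fan m.+2 fan_outer.
Proof.
split; first exact: fan_two_connected.
  by split; [exact: fan_plane|rewrite fan_faces setU11|exact: fan_outer_verts].
move=> F; rewrite fan_interior => /imsetP[j _ ->].
by split; [apply: card_fan_inner|apply: card_fan_inner_verts]; apply: ltn_ord.
Qed.

Definition fan_block (j : nat) : {set W} :=
  inord 0 |: [set v : W | ((m * j).+1 <= v < (m * j.+1).+2)%N].

Definition fan_hypergraph : {set {set W}} := [set fan_block (val j) | j in 'I_f].

Lemma fan_hypergraph_k_angulation : k_angulation_hypergraph m.+2 fan_hypergraph.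
Proof.
exists fan, fan_outer; split; first exact: fan_k_angulation.
rewrite /face_hypergraph fan_interior -imset_comp; apply: eq_imset => j /=.
by rewrite fan_inner_verts ?ltn_ord.
Qed.

Lemma fan_block_inj : injective (fun j : 'I_f => fan_block (val j)).
Proof.
have lt (i j : 'I_f) : (i < j)%N -> fan_block (val i) <> fan_block (val j).
  move=> ij /setP/(_ (inord (m * i).+1)); rewrite !inE /= -val_eqE /=.
  have iN : ((m * i).+1 <= N)%N by apply: spoke_le; apply: ltnW.
  have lij : (m * i < m * j)%N by rewrite ltn_pmul2l.
  have mi : (m * i.+1 = m * i + m)%N by rewrite mulnS addnC.
  rewrite !inordK ?ltnS // mi.
  by move: lij m_gt0; move: (m * i)%N (m * j)%N; clear; lia.
move=> i j E; apply: val_inj; case: (ltngtP i j) => // h; first by case: (lt _ _ h).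
by case: (lt _ _ h).
Qed.

End Fan.

(** * The spectral radius of the fan *)
Section FanWeight.
Variable R : realType.

Lemma exists_root (k : nat) (z : R) : (0 < k)%N -> 0 <= z ->
  exists2 y : R, 0 <= y & y ^+ k = z.
Proof.
move=> k0 z0; exists (z `^ k%:R^-1); first exact: powR_ge0.
rewrite -powR_mulrn ?powR_ge0 // -powRrM mulVf ?powRr1 //.
by rewrite pnatr_eq0 -lt0n.
Qed.

Lemma bernoulli_le (x : R) n : 0 <= x <= 1 -> 1 - n%:R * x <= (1 - x) ^+ n.
Proof.
move=> /andP[x0 x1]; elim: n => [|n IH]; first by rewrite mul0r subr0 expr0.
rewrite exprS; apply: (@le_trans _ _ ((1 - x) * (1 - n%:R * x))); last first.
  by apply: ler_wpM2l; rewrite // subr_ge0.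
rewrite -natr1; have : 0 <= n%:R * x ^+ 2 by rewrite mulr_ge0 ?sqr_ge0.
by rewrite expr2 => h; lra.
Qed.

(** Feasible coordinates are at most 1, so the supremum is over a bounded set. *)
Lemma hpoly_le_spectral_radius (k : nat) (V : finType) (H : {set {set V}}) (x : V -> R) :
  (0 < k)%N -> feasible k x -> hpoly k H x <= spectral_radius R k H.
Proof.
move=> k0 fx; apply: ub_le_sup; last by exists x.
exists (k%:R * #|H|%:R) => _ [y [y0 y1] <-].
rewrite /hpoly ler_wpM2l // -sum1_card natr_sum; apply: ler_sum => e _.
apply: le_trans (_ : \prod_(v in e) (1 : R) <= _); last by rewrite big1_eq.
apply: ler_prod => v _; rewrite y0 /=.
rewrite -(@ler_pXn2r _ k) ?nnegrE // expr1n -y1 (bigD1 v) //= lerDl.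
by apply: sumr_ge0 => w _; rewrite exprn_ge0.
Qed.

Lemma hpoly_fan (m f : nat) (Y : nat -> R) (a b : R) (k : nat) :
  (0 < m)%N -> (0 < f)%N ->
  (forall i, Y i.+1 = if (m %| i)%N then a else b) ->
  hpoly k (fan_hypergraph m f) (fun v => Y (val v))
    = k%:R * (f%:R * (Y 0%N * (a * a * b ^+ m.-1))).
Proof.
move=> m0 f0 YE; rewrite /hpoly /fan_hypergraph; congr (_ * _).
rewrite big_imset /=; last by move=> i j _ _; apply: (fan_block_inj m0).
rewrite (eq_bigr (fun=> Y 0%N * (a * a * b ^+ m.-1))); last first.
  move=> j _; rewrite /fan_block big_setU1 /=; last by rewrite !inE inordK.
  rewrite inordK //; congr (_ * _).
  have bN : ((m * j.+1).+2 <= (m * f).+2)%N.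
    by rewrite !ltnS leq_pmul2l.
  rewrite (eq_bigl (fun v : 'I_(m * f).+2 => (m * j).+1 <= v < (m * j.+1).+2)%N); last first.
    by move=> v; rewrite inE.
  rewrite -(big_mkord (fun i => (m * j).+1 <= i < (m * j.+1).+2)%N Y).
  rewrite -(big_nat_widen 0 (m * j.+1).+2 _ (fun i => (m * j).+1 <= i)%N Y) //.
  rewrite -(big_nat_widenl (m * j).+1 0 (m * j.+1).+2 xpredT Y) //.
  rewrite big_nat_recr /=; last by rewrite ltnS leq_pmul2l // leqnSn.
  rewrite big_ltn; last by rewrite ltnS ltn_pmul2l.
  rewrite !YE !dvdn_mulr // [X in a * X * a](_ : _ = b ^+ m.-1); first by ring.
  rewrite (eq_big_nat _ _ (F2 := fun=> b)); last first.
    case=> [|i] // /andP[ij ji]; rewrite YE; case: ifP => // /dvdnP[q iq].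
    move: ij ji; rewrite !ltnS iq (mulnC q) !ltn_pmul2l // => ij.
    by rewrite ltnS leqNgt ij.
  by rewrite prodr_const_nat mulnS; congr (_ ^+ _); move: (m * j)%N m0; clear; lia.
by rewrite big_const_ord iter_addr_0 mulr_natl.
Qed.

Lemma sum_fan_weight (m f : nat) (t : R) : (0 < m)%N ->
  \sum_(0 <= i < m * f) (if (m %| i)%N then 2 * t else t) = (m.+1 * f)%:R * t.
Proof.
move=> m0; elim: f => [|f IH]; first by rewrite !muln0 big_nil mul0r.
rewrite (@big_cat_nat _ _ _ (m * f)) ?leq0n //=; last by rewrite leq_pmul2l.
rewrite IH big_ltn; last by rewrite ltn_pmul2l.
rewrite dvdn_mulr // (eq_big_nat _ _ (F2 := fun=> t)); last first.
  move=> i /andP[ij ji]; case: ifP => // /dvdnP[q iq].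
  move: ij ji; rewrite iq (mulnC q) !ltn_pmul2l // => ij.
  by rewrite ltnS leqNgt ij.
rewrite GRing.sumr_const_nat.
have -> : (m * f.+1 - (m * f).+1 = m.-1)%N.
  by rewrite mulnS; move: (m * f)%N m0; clear; lia.
rewrite mulnS natrD [RHS]mulrDl [RHS]addrC; congr (_ + _).
by rewrite -mulr_natl -[m in RHS](prednK m0) -!natr1; ring.
Qed.

(** The masses [1/k], [2t], [t] on the hub, the spoke ends and the remaining
    vertices would be optimal without the boundary effect at the two outer
    spokes; the [k]-th power of the polynomial is then [4 f (1 - 2/D)^(k-1)] with
    [D = (k-1) f + 2]. *)
Lemma fan_spectral_radius (k f : nat) : (3 <= k)%N -> (2 <= f)%N ->
  exists2 H : {set {set 'I_((k - 2) * f).+2}}, k_angulation_hypergraph k H &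
    4 * f%:R - 8 <= spectral_radius R k H ^+ k.
Proof.
move=> k3 f2; set m := (k - 2)%N; have m0 : (0 < m)%N by lia.
have km : k = m.+2 by lia.
have f0 : (0 < f)%N by lia.
exists (fan_hypergraph m f).
  by have := fan_hypergraph_k_angulation m0 f0; rewrite -km.
have k0 : (0 < k)%N by lia.
have kR : 0 < k%:R :> R by rewrite ltr0n.
pose D : R := (m.+1 * f)%:R + 2; have D0 : 0 < D by rewrite ltr_wpDl.
pose t : R := (m.+1)%:R / (k%:R * D).
have t0 : 0 <= t by rewrite divr_ge0 // mulr_ge0 // ltW.
have t2 : 0 <= 2 * t by rewrite mulr_ge0.
have ki : 0 <= k%:R^-1 :> R by rewrite invr_ge0.
have [a a0 ak] := exists_root k0 t2.
have [b b0 bk] := exists_root k0 t0.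
have [c c0 ck] := exists_root k0 ki.
pose Y i := if i is i'.+1 then (if (m %| i')%N then a else b) else c.
have Yk i : Y i.+1 ^+ k = if (m %| i)%N then 2 * t else t.
  by rewrite /Y; case: ifP.
have fY : feasible k (fun v : 'I_(m * f).+2 => Y (val v)).
  split; first by move=> v; rewrite /Y; case: (val v) => // i; case: ifP.
  rewrite big_ord_recl /= ck.
  rewrite (eq_bigr (fun i : 'I_(m * f).+1 => if (m %| i)%N then 2 * t else t)); last first.
    by move=> i _; rewrite -Yk.
  rewrite -(big_mkord xpredT (fun i => if (m %| i)%N then 2 * t else t)).
  rewrite big_nat_recr //= sum_fan_weight // dvdn_mulr // -mulrDl -/D.
  rewrite /t km -!natr1; have : k%:R != 0 :> R by rewrite gt_eqF.
  rewrite km -!natr1 => kn0; field; rewrite kn0 gt_eqF //.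
have := hpoly_le_spectral_radius (fan_hypergraph m f) k0 fY.
rewrite (@hpoly_fan m f Y a b) //.
set P := k%:R * _ => hP.
have P0 : 0 <= P by rewrite !mulr_ge0 ?exprn_ge0.
apply: le_trans (_ : P ^+ k <= _); last by rewrite ler_pXn2r ?nnegrE // (le_trans P0).
have -> : P ^+ k = 4 * f%:R * (1 - 2 / D) ^+ m.+1.
  have -> : 1 - 2 / D = k%:R * f%:R * t.
    have kn0 : k%:R != 0 :> R by rewrite gt_eqF.
    have Dn0 : D != 0 by rewrite gt_eqF.
    have DE : D - 2 = m.+1%:R * f%:R by rewrite /D natrM addrK.
    rewrite /t; transitivity ((D - 2) / D); first by field.
    by rewrite DE; field; rewrite kn0 Dn0.
  clearbody t; rewrite /P !exprMn ck ak (exprAC b) bk.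
  have -> : k%:R ^+ k = k%:R ^+ m.+1 * k%:R :> R by rewrite km -exprSr.
  have -> : f%:R ^+ k = f%:R * f%:R ^+ m.+1 :> R by rewrite km -exprS.
  have -> : t ^+ m.+1 = t * t * t ^+ m.-1.
    by rewrite -[in LHS](prednK m0) !exprS mulrA.
  by field; rewrite gt_eqF.
have D2 : 2 / D <= 2 / (m.+1 * f)%:R.
  rewrite ler_pM2l // lef_pV2 ?posrE // ?ltr0n ?muln_gt0 //.
  by rewrite lerDl.
have := @bernoulli_le (2 / D) m.+1.
have -> : 0 <= 2 / D <= 1.
  rewrite divr_ge0 ?(ltW D0) //= ler_pdivrMr // mul1r /D lerDr //.
move=> /(_ isT) hB.
have f4 : 0 < 4 * f%:R :> R by rewrite mulr_gt0 ?ltr0n.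
apply: le_trans (_ : 4 * f%:R * (1 - 2 / f%:R) <= _).
  by rewrite le_eqVlt; apply/orP; left; apply/eqP; field; rewrite gt_eqF ?ltr0n.
rewrite ler_pM2l //; apply: le_trans hB; rewrite lerD2l lerN2.
apply: le_trans (_ : (m.+1)%:R * (2 / (m.+1 * f)%:R) <= _).
  by rewrite ler_wpM2l.
by rewrite natrM le_eqVlt; apply/orP; left; apply/eqP; field; rewrite !gt_eqF ?ltr0n.
Qed.

End FanWeight.

(** * Linear upper bounds for the polynomial *)
Section Weights.
Variables (R : realType) (V : finType) (k : nat).
Hypothesis k3 : (3 <= k)%N.

Let k_gt0 : (0 < k)%N. Proof. by apply: leq_trans k3. Qed.

Lemma weighted_AMGM (e : {set V}) (c x : V -> R) :
  #|e| = k -> (forall v, 0 <= c v) -> (forall v, 0 <= x v) ->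
  1 <= \prod_(v in e) c v ->
  k%:R * \prod_(v in e) x v <= \sum_(v in e) c v * x v ^+ k.
Proof.
move=> ek c0 x0 c1.
have P0 : 0 <= \prod_(v in e) x v by apply: prodr_ge0.
rewrite -(@ler_pXn2r _ k) ?nnegrE ?mulr_ge0 //; last first.
  by apply: sumr_ge0 => v _; rewrite mulr_ge0 ?exprn_ge0.
have := leif_AGM_scaled (A := mem e) (E := fun v => c v * x v ^+ k).
case=> [v _|]; first by rewrite mulrn_wge0 // mulr_ge0 ?exprn_ge0.
rewrite /= ek => + _; apply: le_trans.
rewrite [X in _ <= X](eq_bigr (fun v => c v * x v ^+ k * k%:R)) => [|v _]; last first.
  by rewrite mulr_natr.
rewrite !big_split /= prodrXl prodr_const ek exprMn [X in _ <= X]mulrC.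
by rewrite ler_wpM2l ?exprn_ge0 // ler_peMl ?exprn_ge0.
Qed.

(** Used for the faces assigned to, and the vertices near, distinct heavy vertices. *)
Lemma sum_disjoint_le (I J : finType) (A : {set I}) (S : I -> {set J})
    (T : {set J}) (phi : J -> R) :
  (forall j, 0 <= phi j) -> (forall i, i \in A -> S i \subset T) ->
  (forall i i' j, i \in A -> i' \in A -> j \in S i -> j \in S i' -> i = i') ->
  \sum_(i in A) \sum_(j in S i) phi j <= \sum_(j in T) phi j.
Proof.
move=> phi0 ST disj; rewrite (exchange_big_dep (mem T)) /=; last first.
  by move=> i j iA; apply: (subsetP (ST i iA)).
apply: ler_sum => j _.
case: (pickP (fun i => (i \in A) && (j \in S i))) => [i /andP[iA ji]|none].
  rewrite (big_pred1 i) // => i' /=; apply/andP/eqP => [[i'A ji']|->] //.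
  exact: disj ji.
by rewrite big_pred0.
Qed.

Variables (H B : {set {set V}}).
Hypothesis acc : accretion k H B.
Variable x : V -> R.
Hypothesis x_ge0 : forall v, 0 <= x v.
Hypothesis x_unit : \sum_v x v ^+ k = 1.

Let y v := x v ^+ k.
Let w (e : {set V}) := k%:R * \prod_(v in e) x v.

Let y_ge0 v : 0 <= y v. Proof. exact: exprn_ge0. Qed.

Let w_ge0 e : 0 <= w e. Proof. by rewrite mulr_ge0 // prodr_ge0. Qed.

Lemma coord_le1 v : x v <= 1.
Proof.
rewrite -(@ler_pXn2r _ k) ?nnegrE // expr1n -x_unit (bigD1 v) //= lerDl.
by apply: sumr_ge0 => u _; rewrite exprn_ge0.
Qed.

(** In each face the removed vertex [r e] has mass at most [eps] and gets the
    weight [al]; all others get the weight [g], and each of them is counted at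
    most three times.  The two totals are balanced by [g ^+ k = f * eps]. *)
Lemma light_edges_bound (P : pred {set V}) (eps g f : R) :
  0 < eps -> 0 < g -> #|H|%:R <= f -> 0 < f -> g ^+ k = f * eps ->
  (forall e u, e \in H -> P e -> u \in e -> y u <= eps) ->
  \sum_(e in H | P e) w e <= 4 * g.
Proof.
move=> eps0 g0 Hf f0 gk light.
have [r [rH r3]] := accretion_choice k3 acc.
pose al := g / (f * eps); have fe0 : 0 < f * eps by rewrite mulr_gt0.
have al0 : 0 <= al by rewrite ltW // divr_gt0.
pose c e u := if u == r e then al else g.
apply: (@le_trans _ _ (\sum_(e in H | P e) (al * eps + \sum_(u in e | u != r e) g * y u))).
  apply: ler_sum => e /andP[eH Pe].
  apply: le_trans (_ : \sum_(u in e) c e u * y u <= _).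
    apply: weighted_AMGM => //; first exact: accretion_card acc eH.
      by move=> v; rewrite /c; case: ifP => _ //; apply: ltW.
    rewrite (bigD1 (r e)) ?rH //= /c eqxx.
    rewrite (eq_bigr (fun=> g)) => [|u /andP[_ /negbTE ->] //].
    rewrite prodr_const; have -> : #|[pred u | (u \in e) && (u != r e)]| = k.-1.
      have := cardsD1 (r e) e; rewrite rH // (accretion_card acc eH) => ->.
      by rewrite add1n /=; apply: eq_card => u; rewrite !inE andbC.
    by rewrite /al mulrAC -exprS prednK // gk divff // gt_eqF.
  rewrite (bigD1 (r e)) ?rH //= lerD //.
    by rewrite /c eqxx ler_wpM2l // (light e) // rH.
  apply: ler_sum => u /andP[_ /negbTE ur]; by rewrite /c ur.
rewrite big_split /=; apply: (@le_trans _ _ (g + 3 * g)); last by lra.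
apply: lerD.
  apply: (@le_trans _ _ (\sum_(e in H) al * eps)).
    rewrite big_mkcondr; apply: ler_sum => e _; case: ifP => // _.
    by rewrite mulr_ge0 // ltW.
  rewrite big_const iter_addr_0 -[X in X <= _]mulr_natl.
  apply: le_trans (_ : f * (al * eps) <= _).
    by rewrite ler_wpM2r // mulr_ge0 // ltW.
  by rewrite /al le_eqVlt; apply/orP; left; apply/eqP; field; rewrite !gt_eqF.
apply: (@le_trans _ _ (\sum_u (3 * g) * y u)); last by rewrite -mulr_sumr x_unit mulr1.
rewrite (exchange_big_dep xpredT) //=; apply: ler_sum => u _.
rewrite big_const iter_addr_0 -[X in X <= _]mulr_natl -[X in _ <= X]mulrA; apply: ler_wpM2r.
  by rewrite mulr_ge0 // ltW.
rewrite ler_nat; apply: leq_trans (r3 u).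
apply/subset_leq_card/subsetP => e; rewrite !inE => /andP[/andP[-> _] /andP[-> ->]] //.
Qed.

Variable L : {set V}.

(** A face at a heavy vertex [v] is crowded when another of its vertices shares a
    face with a second heavy vertex.  As a vertex shares a face with itself,
    this includes the faces with two heavy vertices. *)
Definition crowded (e : {set V}) : bool :=
  [exists v in L, (v \in e) && [exists u in e, (u != v) &&
    [exists w in L, (w != v) && cofacial H u w]]].

Lemma crowdedI (e : {set V}) v u v' : v \in L -> v \in e -> u \in e -> u != v ->
  v' \in L -> v' != v -> cofacial H u v' -> crowded e.
Proof.
move=> vL ve ue uv v'L v'v cf; apply/existsP; exists v; rewrite vL ve /=.
apply/existsP; exists u; rewrite ue uv /=.
by apply/existsP; exists v'; rewrite v'L v'v.
Qed.

Definition star v : {set {set V}} := [set e in H | (v \in e) && ~~ crowded e].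

Definition link v : {set V} := [set u | (u != v) && [exists e in star v, u \in e]].

Lemma starP e v : reflect [/\ e \in H, v \in e & ~~ crowded e] (e \in star v).
Proof. by rewrite inE; apply: and3P. Qed.

Lemma linkP u v : reflect (u != v /\ exists2 e, e \in star v & u \in e) (u \in link v).
Proof.
rewrite inE; apply: (iffP andP) => -[uv].
  by case/existsP=> e /andP[es ue]; split=> //; exists e.
by case=> e es ue; split=> //; apply/existsP; exists e; rewrite es.
Qed.

Lemma star_uniq v v' e : v \in L -> v' \in L -> e \in star v -> e \in star v' -> v = v'.
Proof.
move=> vL v'L /starP[eH ve nc] /starP[_ v'e _]; apply/eqP/negPn/negP => vv'.
case/negP: nc; apply: (@crowdedI e v v' v') => //; rewrite 1?eq_sym //.
by apply/existsP; exists e; rewrite eH v'e.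
Qed.

Lemma link_uniq v v' u : v \in L -> v' \in L -> u \in link v -> u \in link v' -> v = v'.
Proof.
move=> vL v'L /linkP[uv [e /starP[eH ve nc] ue]] /linkP[_ [e' /starP[e'H v'e' _] ue']].
apply/eqP/negPn/negP => vv'.
case/negP: nc; apply: (@crowdedI e v u v') => //; rewrite 1?eq_sym //.
by apply/existsP; exists e'; rewrite e'H ue' v'e'.
Qed.

Lemma link_light v : v \in L -> link v \subset ~: L.
Proof.
move=> vL; apply/subsetP => u /linkP[uv [e /starP[eH ve nc] ue]].
rewrite inE; apply: contra nc => uL.
apply: (@crowdedI e v u u) => //.
by apply/existsP; exists e; rewrite eH ue.
Qed.

Lemma sum_link : \sum_(v in L) \sum_(u in link v) y u <= 1 - \sum_(v in L) y v.
Proof.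
apply: le_trans (sum_disjoint_le y_ge0 link_light _) _.
  by move=> v v' u; apply: link_uniq.
have : \sum_v y v = \sum_(v in L) y v + \sum_(v in ~: L) y v.
  rewrite (bigID (mem L)) /=; congr (_ + _).
  by apply: eq_bigl => u; rewrite !inE.
by rewrite x_unit; lra.
Qed.

Lemma sum_star : \sum_(v in L) #|star v|%:R <= #|H|%:R :> R.
Proof.
have E (T : finType) (S : {set T}) : #|S|%:R = \sum_(j in S) 1 :> R.
  by rewrite -sum1_card natr_sum.
under eq_bigr do rewrite E; rewrite E; apply: sum_disjoint_le => //.
  by move=> v _; apply/subsetP => e /starP[].
by move=> v v' e; apply: star_uniq.
Qed.

(** The weight [be / codegree u v] compensates for the number of faces at [v]
    that contain [u]; over the vertices [u <> v] of one face the codegrees multiply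
    to at most 4. *)
Lemma star_bound v (al be : R) : 0 <= al -> 0 <= be -> 4 <= al * be ^+ k.-1 ->
  \sum_(e in star v) w e <= al * #|star v|%:R * y v + be * \sum_(u in link v) y u.
Proof.
move=> al0 be0 ab.
pose c u := if u == v then al else be / (codegree H u v)%:R.
apply: (@le_trans _ _ (\sum_(e in star v) (al * y v + \sum_(u in e | u != v) c u * y u))).
  apply: ler_sum => e /starP[eH ve _].
  have ek := accretion_card acc eH.
  apply: le_trans (_ : \sum_(u in e) c u * y u <= _); last first.
    by rewrite (bigD1 v) //= {1}/c eqxx.
  apply: weighted_AMGM => //.
    by move=> u; rewrite /c; case: ifP => // _; rewrite divr_ge0.
  rewrite (bigD1 v) //= {1}/c eqxx.
  pose n u := codegree H u v.
  rewrite (eq_bigr (fun u => be / (n u)%:R)) => [|u /andP[_ /negbTE uv]]; last by rewrite /c uv.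
  rewrite big_split /= prodr_const prodfV -natr_prod.
  have -> : #|[pred u | (u \in e) && (u != v)]| = k.-1.
    have := cardsD1 v e; rewrite ve ek => ->.
    by rewrite add1n /=; apply: eq_card => u; rewrite !inE andbC.
  have n4 : (\prod_(u in e | u != v) n u <= 4)%N.
    apply: leq_trans (_ : 2 ^ #|[set u in e | (u != v) && (2 <= n u)%N]| <= _)%N; last first.
      by rewrite -[4%N]/(2 ^ 2)%N leq_exp2l // (accretion_shared acc eH ve).
    rewrite -prod_nat_const big_mkcond [X in (_ <= X)%N]big_mkcond.
    apply: leq_prod => u _; rewrite !inE.
    case: (u \in e) => //=; case: eqVneq => //= uv.
    case: ltnP => h; first exact: accretion_codegree acc uv.
    exact: h.
  have n0 : (0 < \prod_(u in e | u != v) n u)%N.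
    rewrite prodn_cond_gt0 // => u /andP[ue uv]; apply/card_gt0P; exists e.
    by rewrite inE eH ue ve.
  rewrite mulrA ler_pdivlMr ?ltr0n // mul1r; apply: le_trans ab.
  by rewrite ler_nat.
rewrite big_split /= big_const iter_addr_0 -[X in X + _ <= _]mulr_natr mulrAC.
rewrite lerD2l (exchange_big_dep (mem (link v))) /=; last first.
  by move=> e u es /andP[ue uv]; apply/linkP; split=> //; exists e.
rewrite mulr_sumr; apply: ler_sum => u /linkP[uv [e0 /starP[e0H ve0 _] ue0]].
rewrite big_const iter_addr_0 -[X in X <= _]mulr_natr mulrAC; apply: ler_wpM2r => //.
rewrite /c (negbTE uv); have cd : (0 < codegree H u v)%N.
  by apply/card_gt0P; exists e0; rewrite inE e0H ue0 ve0.
rewrite mulrAC ler_pdivrMr ?ltr0n // ler_wpM2l // ler_nat.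
apply/subset_leq_card/subsetP => e /andP[/starP[eH ve _] /andP[ue _]].
by rewrite inE eH ue ve.
Qed.

(** A crowded face is determined, up to two choices, by two heavy vertices and one
    of the at most [2 k] vertices near both. *)
Lemma card_crowded : (#|[set e in H | crowded e]| <= 4 * k * #|L| ^ 2)%N.
Proof.
pose C v v' := [set u | cofacial H u v && cofacial H u v'].
apply: (@leq_trans (\sum_(v in L) \sum_(v' in L | v' != v) \sum_(u in C v v' | u != v)
    codegree H u v)%N).
  have sub : [set e in H | crowded e] \subset
      \bigcup_(v in L) \bigcup_(v' in L | v' != v) \bigcup_(u in C v v' | u != v)
        [set e in H | (u \in e) && (v \in e)].
    apply/subsetP => e; rewrite inE => /andP[eH /existsP[v /and3P[vL ve]]].
    case/existsP=> u /and3P[ue uv /existsP[v' /and3P[v'L v'v cf]]].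
    apply/bigcupP; exists v => //; apply/bigcupP; exists v'; first by rewrite v'L.
    apply/bigcupP; exists u; last by rewrite inE eH ue.
    rewrite uv andbT inE cf andbT; apply/existsP; exists e; by rewrite eH ue.
  have bigU (T : finType) (P : pred T) (F : T -> {set {set V}}) :
      (#|\bigcup_(i | P i) F i| <= \sum_(i | P i) #|F i|)%N.
    elim/big_rec2: _ => [|i n S _ h]; first by rewrite cards0.
    by apply: leq_trans (leq_card_setU _ _) _; rewrite leq_add2l.
  apply: leq_trans (subset_leq_card sub) _; apply: leq_trans (bigU _ _ _) _.
  apply: leq_sum => v _; apply: leq_trans (bigU _ _ _) _.
  apply: leq_sum => v' _; exact: bigU.
apply: (@leq_trans (\sum_(v in L) \sum_(v' in L) 4 * k)%N); last first.
  rewrite !sum_nat_const -mulnn; move: #|L| => l.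
  by rewrite mulnA mulnC.
apply: leq_sum => v vL; rewrite big_mkcondr /=; apply: leq_sum => v' v'L.
case: ifP => // v'v.
apply: (@leq_trans (\sum_(u in C v v') 2)%N).
  rewrite big_mkcondr; apply: leq_sum => u _; case: ifP => // uv.
  exact: accretion_codegree acc uv.
rewrite sum_nat_const mulnC -[4%N]/(2 * 2)%N -mulnA leq_mul2l /=.
by rewrite (accretion_cofacial acc) // eq_sym.
Qed.

Lemma hpoly_bound (eps g f al be : R) :
  0 < eps -> 0 < g -> #|H|%:R <= f -> 0 < f -> g ^+ k = f * eps ->
  (forall u, u \notin L -> y u <= eps) ->
  0 <= al -> 0 <= be -> 4 <= al * be ^+ k.-1 ->
  hpoly k H x <= 4 * g + 4 * k%:R ^+ 2 * #|L|%:R ^+ 2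
     + al * \sum_(v in L) #|star v|%:R * y v + be * (1 - \sum_(v in L) y v).
Proof.
move=> eps0 g0 Hf f0 gk light al0 be0 ab.
rewrite /hpoly mulr_sumr -/(w _) (bigID (fun e : {set V} => [disjoint e & L])) /=.
rewrite -!addrA; apply: lerD.
  apply: (light_edges_bound eps0 g0 Hf f0 gk) => e u _ dis ue; apply: light.
  by rewrite (disjointFr dis).
rewrite (bigID crowded) /=; apply: lerD.
  apply: (@le_trans _ _ (\sum_(e in [set e in H | crowded e]) k%:R)).
    rewrite [X in _ <= X](eq_bigl _ _ (fun e => in_set _ e)).
    rewrite big_mkcondr /= big_mkcond [X in _ <= X]big_mkcond.
    apply: ler_sum => e _; case: (e \in H); rewrite /= ?andbF //; case: (crowded e) => //=; last by case: ifP.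
    case: ifP => // _; rewrite /w -[X in _ <= X]mulr1 ler_wpM2l //.
    by apply: prodr_ile1 => v; rewrite x_ge0 coord_le1.
  rewrite big_const iter_addr_0 -[X in X <= _]mulr_natr.
  have := card_crowded; rewrite -(ler_nat R) !natrM => /(ler_wpM2l (ler0n R k)).
  by move/le_trans; apply; rewrite le_eqVlt; apply/orP; left; apply/eqP; ring.
(* What remains has a heavy vertex and is not crowded. *)
apply: (@le_trans _ _ (\sum_(v in L) \sum_(e in star v) w e)).
  rewrite (exchange_big_dep (mem H)) /=; last by move=> v e _ /starP[].
  rewrite big_mkcond [X in _ <= X]big_mkcond; apply: ler_sum => e _.
  case: (boolP (_ && _)) => [/andP[/andP[eH nd] nc]|_]; last first.
    by case: ifP => // _; apply: sumr_ge0.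
  rewrite eH; move: nd; rewrite -setI_eq0 => /set0Pn[v /setIP[ve vL]].
  rewrite [X in _ <= X](bigD1 v) /=; last first.
    by apply/andP; split=> //; apply/starP.
  by rewrite lerDl sumr_ge0.
rewrite !mulr_sumr.
apply: (@le_trans _ _ (\sum_(v in L) (al * #|star v|%:R * y v + be * \sum_(u in link v) y u))).
  by apply: ler_sum => v _; apply: star_bound.
rewrite big_split /= lerD //.
  by apply: ler_sum => v _; rewrite mulrA.
by rewrite -mulr_sumr ler_wpM2l // sum_link.
Qed.

End Weights.

(** * Comparison of the two bounds *)

Lemma expr1D_le_quadratic (R : realFieldType) (s : R) n : -1 <= s <= 1 ->
  (1 + s) ^+ n <= 1 + n%:R * s + 3 ^+ n * s ^+ 2.
Proof.
move=> /andP[s1 s2]; elim: n => [|n IH]; first by rewrite !expr0 mul0r mul1r addr0 lerDl sqr_ge0.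
have s0 : 0 <= 1 + s by lra.
rewrite exprS; apply: le_trans (ler_wpM2l s0 IH) _.
rewrite -[n.+1%:R]natr1 [3 ^+ n.+1]exprS; have n3 : n%:R <= 3 ^+ n :> R.
  by rewrite -natrX ler_nat ltnW // ltn_expl.
have P0 : 0 <= 3 ^+ n :> R by rewrite exprn_ge0.
have ss : 0 <= s ^+ 2 by rewrite sqr_ge0.
have h1 : n%:R * s ^+ 2 <= 3 ^+ n * s ^+ 2 by rewrite ler_wpM2r.
have h2 : 3 ^+ n * s ^+ 2 * s <= 3 ^+ n * s ^+ 2.
  by rewrite -[X in _ <= X]mulr1 ler_wpM2l // mulr_ge0.
rewrite -subr_ge0 [X in 0 <= X](_ : _ = (3 ^+ n * s ^+ 2 - n%:R * s ^+ 2)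
  + (3 ^+ n * s ^+ 2 - 3 ^+ n * s ^+ 2 * s)); last by ring.
by rewrite addr_ge0 // subr_ge0.
Qed.

Lemma expr1D_le_linear (R : realFieldType) (c d : R) n : 0 <= c -> 0 <= d <= 1 ->
  (1 + c * d) ^+ n <= 1 + (1 + c) ^+ n * d.
Proof.
move=> c0 /andP[d0 d1].
suff h : (1 + c * d) ^+ n <= 1 + ((1 + c) ^+ n - 1) * d by lra.
elim: n => [|n IH]; first by rewrite !expr0; lra.
have cd0 : 0 <= 1 + c * d by rewrite addr_ge0 // mulr_ge0.
rewrite exprS; apply: le_trans (ler_wpM2l cd0 IH) _.
rewrite exprS; set A := (1 + c) ^+ n; have A1 : 1 <= A by rewrite exprn_ege1 // lerDl.
have : c * (A - 1) * d * d <= c * (A - 1) * d.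
  by rewrite -[X in _ <= X]mulr1 ler_wpM2l // !mulr_ge0 // subr_ge0.
by lra.
Qed.

(** Here [d], [phi] and [la] stand for [f^(-rho)], [f^(1/k)] and [(4 f)^(1/k)].
    The value of [rho] matters for [phid], which makes the [O(d^(-2k))] crowded
    faces as cheap as the light ones. *)
Section ExtremalEstimates.
Variables (R : realType) (k : nat) (V : finType).
Hypothesis k3 : (3 <= k)%N.
Variables (H B : {set {set V}}).
Hypothesis acc : accretion k H B.
Variable x : V -> R.
Hypothesis x_ge0 : forall v, 0 <= x v.
Hypothesis x_unit : \sum_v x v ^+ k = 1.
Variables v1 v2 : V.
Hypothesis v12 : v1 != v2.
Hypothesis x_max : forall v, x v <= x v1.
Variables f d phi la : R.
Hypotheses (f2 : 2 <= f) (Hf : #|H|%:R <= f).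
Hypotheses (d_gt0 : 0 < d) (d_le1 : d <= 1) (fd : 1 <= f * d).
Hypotheses (phi_gt0 : 0 < phi) (phik : phi ^+ k = f) (phid : 1 <= phi * d ^+ (2 * k).+1).
Hypotheses (la_gt0 : 0 < la) (lak : la ^+ k = 4 * f).
Hypothesis h_lower : 4 * f - 8 <= hpoly k H x ^+ k.

(** The light faces account for 4, the lower bound on the spectral radius for 2,
    and the crowded faces for [36 k^2]: at most [4 k |L|^2] of them, each
    contributing at most [k], with [|L| <= 3 / d^k]. *)
Definition error_constant : R := 6 + 36 * k%:R ^+ 2.

Let y v := x v ^+ k.
Let y_ge0 v : 0 <= y v. Proof. exact: exprn_ge0. Qed.
Let k_gt0 : (0 < k)%N. Proof. exact: leq_trans k3. Qed.
Let f_gt0 : 0 < f. Proof. by apply: lt_le_trans f2. Qed.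

Let L : {set V} := [set v | d ^+ k <= y v] :|: [set v1; v2].

(** At most [1 / d^k] vertices have mass [d^k] or more, and [v1], [v2] add 2. *)
Lemma card_heavy : #|L|%:R <= 3 / d ^+ k.
Proof.
have e0 : 0 < d ^+ k by rewrite exprn_gt0.
have e1 : d ^+ k <= 1 by rewrite exprn_ile1 // ltW.
rewrite ler_pdivlMr //; pose S := [set v | d ^+ k <= y v].
have : (#|L| <= #|S| + 2)%N.
  by rewrite (leq_trans (leq_card_setU _ _)) // leq_add2l cards2; case: (_ != _).
rewrite -(ler_nat R) natrD => h.
have h1 : #|S|%:R * d ^+ k <= 1.
  rewrite -[X in _ <= X]x_unit mulr_natl -sumr_const.
  apply: (@le_trans _ _ (\sum_(v in S) y v)).
    by apply: ler_sum => v; rewrite inE.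
  rewrite [X in _ <= X](bigID (mem S)) /= lerDl.
  by apply: sumr_ge0 => v _; apply: y_ge0.
apply: le_trans (ler_wpM2r (ltW e0) h) _; lra.
Qed.

Lemma error_bound : 4 * (phi * d) + 4 * k%:R ^+ 2 * #|L|%:R ^+ 2
  <= (error_constant - 2) * d * la.
Proof.
have e0 : 0 < d ^+ k by rewrite exprn_gt0.
have h1 : #|L|%:R ^+ 2 <= 9 * (phi * d).
  apply: (@le_trans _ _ ((3 / d ^+ k) ^+ 2)).
    by rewrite ler_pXn2r ?nnegrE ?ler0n ?card_heavy // divr_ge0 // ltW.
  rewrite exprMn exprVn ler_pdivrMr ?exprn_gt0 // -exprM mulnC.
  have -> : 9 * (phi * d) * d ^+ (2 * k) = 9 * (phi * d ^+ (2 * k).+1).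
    by rewrite exprS; ring.
  by rewrite expr2; move: phid; lra.
have phila : phi <= la.
  rewrite -(@ler_pXn2r _ k) ?nnegrE ?ltW // phik lak.
  by move: f_gt0; lra.
have h2 : phi * d <= d * la by rewrite mulrC ler_wpM2l // ltW.
have kk : 0 <= 4 * k%:R ^+ 2 :> R by rewrite mulr_ge0 // sqr_ge0.
apply: le_trans (lerD (lexx _) (ler_wpM2l kk h1)) _.
have -> : 4 * (phi * d) + 4 * k%:R ^+ 2 * (9 * (phi * d)) = (error_constant - 2) * (phi * d).
  by rewrite /error_constant; ring.
rewrite -mulrA ler_wpM2l // /error_constant.
by move: kk; lra.
Qed.

Lemma spectral_upper (tau : R) : 0 < tau ->
  hpoly k H x <= la * ((error_constant - 2) * d
    + tau ^+ k.-1 * \sum_(v in L) #|star H L v|%:R / f * y v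
    + (1 - \sum_(v in L) y v) / tau).
Proof.
move=> tau0.
have al0 : 0 <= la * tau ^+ k.-1 / f.
  by rewrite divr_ge0 ?mulr_ge0 ?exprn_ge0 ?ltW.
have be0 : 0 <= la / tau by rewrite divr_ge0 ?ltW.
(* With these weights, [al * be ^+ k.-1 = la ^+ k / f = 4]. *)
have := @hpoly_bound R V k k3 H B acc x x_ge0 x_unit L (d ^+ k) (phi * d) f
  (la * tau ^+ k.-1 / f) (la / tau).
rewrite exprn_gt0 // mulr_gt0 // exprMn phik.
move=> /(_ isT isT Hf f_gt0 erefl) hb.
have {}hb := hb _ al0 be0 _.
apply: le_trans (hb _ _) _.
- by move=> u; rewrite !inE negb_or -ltNge => /andP[/ltW].
- rewrite expr_div_n; have -> : la * tau ^+ k.-1 / f * (la ^+ k.-1 / tau ^+ k.-1) = la ^+ k / f.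
    rewrite -[in RHS](prednK k_gt0) exprS; field.
    by rewrite !gt_eqF ?exprn_gt0.
  by rewrite lak mulfK // gt_eqF.
have -> : \sum_(v in L) #|star H L v|%:R / f * y v
    = (\sum_(v in L) #|star H L v|%:R * x v ^+ k) / f.
  by rewrite mulr_suml; apply: eq_bigr => v _; rewrite mulrAC.
have := error_bound; rewrite /y; set S1 := \sum_(v in L) _; set S2 := \sum_(v in L) _.
move=> h; rewrite [X in _ <= X](_ : _ = (error_constant - 2) * d * la
  + la * tau ^+ k.-1 / f * S1 + la / tau * (1 - S2)); last by ring.
by rewrite !lerD2r.
Qed.

Lemma spectral_lower : la * (1 - 2 * d) <= hpoly k H x.
Proof.
have q0 : 0 <= 1 - 2 / f by rewrite subr_ge0 ler_pdivrMr // mul1r.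
apply: (@le_trans _ _ (la * (1 - 2 / f))).
  rewrite ler_pM2l // lerD2l lerN2 ler_pM2l // -[_^-1]mul1r ler_pdivrMr //.
  by rewrite mulrC.
have P0 : 0 <= hpoly k H x.
  by apply: mulr_ge0 => //; apply: sumr_ge0 => e _; apply: prodr_ge0.
rewrite -(@ler_pXn2r _ k) ?nnegrE ?P0 ?mulr_ge0 ?(ltW la_gt0) //.
apply: le_trans h_lower; rewrite exprMn lak.
have -> : 4 * f - 8 = 4 * f * (1 - 2 / f) by field; rewrite gt_eqF.
rewrite ler_pM2l ?mulr_gt0 // -[X in _ <= X]expr1 ler_wiXn2l ?k_gt0 ?q0 //.
by rewrite gerBl divr_ge0 // ltW.
Qed.

(** The parameter [tau] shifts weight between the heavy vertices and the rest;
    at [tau = 1] the two sides balance for the extremal profile. *)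
Lemma profile_bound (tau : R) : 0 < tau ->
  1 - error_constant * d <= tau ^+ k.-1 * \sum_(v in L) #|star H L v|%:R / f * y v
    + (1 - \sum_(v in L) y v) / tau.
Proof.
move=> tau0; have := le_trans spectral_lower (spectral_upper tau0).
by rewrite ler_pM2l // => h; lra.
Qed.

Lemma v1_heavy : v1 \in L. Proof. by rewrite !inE eqxx orbT. Qed.
Lemma v2_heavy : v2 \in L. Proof. by rewrite !inE eqxx !orbT. Qed.

Lemma sum_star_le : \sum_(v in L) #|star H L v|%:R / f <= 1.
Proof.
rewrite -mulr_suml ler_pdivrMr // mul1r; apply: le_trans Hf; exact: sum_star.
Qed.

Lemma star_ge0 v : 0 <= #|star H L v|%:R / f :> R.
Proof. by rewrite divr_ge0 // ltW. Qed.

Lemma star_pair : #|star H L v1|%:R / f + #|star H L v2|%:R / f <= 1.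
Proof.
apply: le_trans sum_star_le; rewrite (bigD1 v1) ?v1_heavy //= lerD2l.
rewrite (bigD1 v2) /=; last by rewrite v2_heavy eq_sym.
by rewrite lerDl; apply: sumr_ge0 => v _; apply: star_ge0.
Qed.

Lemma deficit_bound :
  (1 - #|star H L v1|%:R / f) * y v1 + (1 - #|star H L v2|%:R / f) * y v2
    <= error_constant * d.
Proof.
have := profile_bound ltr01; rewrite expr1n mul1r divr1 => h.
apply: (@le_trans _ _ (\sum_(v in L) (1 - #|star H L v|%:R / f) * y v)); last first.
  under eq_bigr do rewrite mulrBl mul1r.
  by rewrite sumrB; lra.
rewrite (bigD1 v1) ?v1_heavy //= lerD2l.
rewrite (bigD1 v2) /=; last by rewrite v2_heavy eq_sym.
rewrite lerDl; apply: sumr_ge0 => v /andP[/andP[vL _] _].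
rewrite mulr_ge0 // subr_ge0; apply: le_trans sum_star_le.
rewrite (bigD1 v) //= lerDl; apply: sumr_ge0 => u _; exact: star_ge0.
Qed.

Lemma upper_estimate : hpoly k H x <= la * (1 + error_constant * d).
Proof.
apply: le_trans (spectral_upper ltr01) _; rewrite expr1n mul1r divr1 ler_pM2l //.
have : \sum_(v in L) #|star H L v|%:R / f * y v <= \sum_(v in L) y v.
  apply: ler_sum => v vL; rewrite ler_piMl //; apply: le_trans sum_star_le.
  rewrite (bigD1 v) //= lerDl; apply: sumr_ge0 => u _; exact: star_ge0.
by move: d_gt0; lra.
Qed.

(** The two coefficients in [deficit_bound] add up to at least 1. *)
Lemma second_estimate : y v2 <= error_constant * d.
Proof.
apply: le_trans deficit_bound.
have y21 : y v2 <= y v1 by rewrite ler_pXn2r ?nnegrE.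
have := star_pair; have := star_ge0 v1; have := star_ge0 v2; have := y_ge0 v2.
move: (_ / f) (_ / f) => a b y0 a0 b0 ab; nra.
Qed.

Lemma degree_estimate : (1 - (degree H v1)%:R / f) * y v1 <= error_constant * d.
Proof.
apply: le_trans deficit_bound.
apply: (@le_trans _ _ ((1 - #|star H L v1|%:R / f) * y v1)).
  rewrite ler_wpM2r // lerD2l lerN2 ler_pM2r ?invr_gt0 // ler_nat.
  by apply/subset_leq_card/subsetP => e /starP[eH ve _]; rewrite inE eH.
rewrite lerDl mulr_ge0 // subr_ge0.
by have := star_pair; have := star_ge0 v1; lra.
Qed.

Lemma first_profile (tau : R) : 0 < tau ->
  1 - error_constant * d <= tau ^+ k.-1 * y v1 + (1 - y v1) / tau.
Proof.
move=> tau0; apply: le_trans (profile_bound tau0) _; apply: lerD.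
  rewrite ler_wpM2l ?exprn_ge0 ?(ltW tau0) //.
  apply: (@le_trans _ _ (\sum_(v in L) #|star H L v|%:R / f * y v1)).
    apply: ler_sum => v _; rewrite ler_wpM2l ?star_ge0 //.
    by rewrite ler_pXn2r ?nnegrE.
  by rewrite -mulr_suml ler_piMl // sum_star_le.
rewrite ler_pM2r ?invr_gt0 // lerD2l lerN2 (bigD1 v1) ?v1_heavy //= lerDl.
by apply: sumr_ge0 => v _; apply: y_ge0.
Qed.

(** The function of [tau] in [first_profile] equals 1 at [tau = 1] with slope
    [k * y v1 - 1]; steps of size [s = sqrt d] in both directions balance the
    linear gain against the quadratic remainder and the error [O(d)]. *)
Lemma first_estimate (s : R) : 0 < s < 1 -> s ^+ 2 = d ->
  `|k%:R * y v1 - 1| <= (3 ^+ k + 2 * error_constant) * s.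
Proof.
move=> /andP[s0 s1] sd; have y1 : y v1 <= 1.
  by rewrite exprn_ile1 // (coord_le1 k3 x_ge0 x_unit).
have C0 : 0 <= error_constant.
  by rewrite /error_constant addr_ge0 // mulr_ge0 // sqr_ge0.
have K0 : 0 <= 3 ^+ k :> R by rewrite exprn_ge0.
have scaled tau : 0 < tau -> tau - 1 - error_constant * d * tau <= (tau ^+ k - 1) * y v1.
  move=> tau0; have := ler_wpM2r (ltW tau0) (first_profile tau0).
  rewrite [X in _ <= X](_ : _ = tau ^+ k * y v1 + (1 - y v1)); last first.
    by rewrite -[in RHS](prednK k_gt0) exprS; field; rewrite gt_eqF.
  by move: (tau ^+ k) => T; lra.
have y0 := y_ge0 v1.
have s1' : -1 <= s <= 1 by lra.
have s2' : -1 <= - s <= 1 by lra.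
have q1 := expr1D_le_quadratic k s1'.
have q2 := expr1D_le_quadratic k s2'; rewrite sqrrN mulrN in q2.
have p1 : 0 < 1 + s by lra.
have p2 : 0 < 1 + - s by lra.
have t1 := scaled _ p1; have t2 := scaled _ p2.
have u1 : ((1 + s) ^+ k - 1) * y v1 <= (k%:R * s + 3 ^+ k * s ^+ 2) * y v1.
  by apply: ler_wpM2r => //; lra.
have u2 : ((1 + - s) ^+ k - 1) * y v1 <= (- (k%:R * s) + 3 ^+ k * s ^+ 2) * y v1.
  by apply: ler_wpM2r => //; lra.
have Ky : 3 ^+ k * y v1 <= 3 ^+ k by rewrite ler_piMr.
have ss0 : 0 <= s * s by rewrite mulr_ge0 // ltW.
have h1 : 3 ^+ k * y v1 * (s * s) <= 3 ^+ k * (s * s) by rewrite ler_wpM2r.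
have h3 : 0 <= error_constant * (s * s) by rewrite mulr_ge0.
have h2 : error_constant * (s * s) * s <= error_constant * (s * s).
  by rewrite ler_piMr // ltW.
have h4 : 0 <= error_constant * (s * s) * s by rewrite mulr_ge0 // ltW.
rewrite -sd expr2 in t1 t2; rewrite expr2 in u1 u2.
have low : (k%:R * y v1 - 1) * s <= (3 ^+ k + 2 * error_constant) * s * s by lra.
have high : (1 - k%:R * y v1) * s <= (3 ^+ k + 2 * error_constant) * s * s by lra.
by rewrite ler_norml; move: low high; rewrite !ler_pM2r // => low high; lra.
Qed.

End ExtremalEstimates.

Theorem theorem1p2 (R : realType) (k : nat) (hk : (3 <= k)%N) :
  exists (f0 : nat) (M : R),
    forall (f : nat) (H : {set {set 'I_((k - 2) * f).+2}})
           (x : 'I_((k - 2) * f).+2 -> R) (s : {perm 'I_((k - 2) * f).+2}),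
      (f0 <= f)%N ->
      extremal R k H ->
      perron_vector k H x ->
      (forall i j : 'I_((k - 2) * f).+2, (i <= j)%N -> x (s j) <= x (s i)) ->
      let v1 := s ord0 in
      let v2 := s (lift ord0 ord0) in
      [/\ `|spectral_radius R k H ^+ k - 4 * f%:R| <=
            M * f%:R `^ (1 - rho R k),
          `|x v1 ^+ k - k%:R^-1| <= M * f%:R `^ (- (rho R k / 2)),
          x v2 ^+ k <= M * f%:R `^ (- rho R k) &
          f%:R - M * f%:R `^ (1 - rho R k / (2 * k%:R)) <=
            (degree H v1)%:R].
Proof.
have k0 : (0 < k)%N by apply: leq_trans hk.
have kR : 1 <= k%:R :> R by rewrite ler1n.
have kR0 : 0 < k%:R :> R by rewrite ltr0n.
pose C := error_constant R k; pose M2 : R := 3 ^+ k + 2 * C.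
have C0 : 0 <= C by rewrite /C /error_constant addr_ge0 // mulr_ge0 // sqr_ge0.
have M20 : 0 <= M2 by rewrite addr_ge0 ?exprn_ge0 // mulr_ge0.
(* [M1], [M2], [C], [M4] are the constants of the four estimates. *)
pose M1 : R := 4 * (1 + C) ^+ k + 8; pose M4 : R := k%:R * (C + M2).
have M10 : 0 <= M1 by rewrite addr_ge0 // mulr_ge0 // exprn_ge0 // addr_ge0.
have M40 : 0 <= M4 by rewrite mulr_ge0 // addr_ge0.
exists 2%N, (M1 + M2 + C + M4) => f H x s f2 [Hk Hmax] [x0 x1 xH] xs v1 v2.
have [[B acc] Hcard] := k_angulation_accretion hk Hk.
set F : R := f%:R; have F2 : 2 <= F by rewrite ler_nat.
have F1 : 1 <= F by lra.
have F0 : 0 < F by lra.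
have Fn0 : F != 0 by rewrite gt_eqF.
have HF : #|H|%:R <= F.
  rewrite ler_nat -(@leq_pmul2l (k - 2)); last by rewrite subn_gt0.
  by move: Hcard; rewrite card_ord addn2 !ltnS.
set r := rho R k; have r0 : 0 < r by rewrite invr_gt0 mulr_gt0 // addr_gt0 // mulr_gt0.
have r1 : r <= 1.
  by rewrite invf_le1 ?mulr_gt0 ?addr_gt0 ?mulr_gt0 // mulr_ege1 // lerDr mulr_ge0.
have addE a b : F `^ (a + b) = F `^ a * F `^ b by rewrite powRD // Fn0 implybT.
set d := F `^ (- r); set sd := F `^ (- (r / 2)).
have d0 : 0 < d by apply: powR_gt0.
have sd0 : 0 < sd by apply: powR_gt0.
have sdd : sd ^+ 2 = d by rewrite expr2 -addE; congr (_ `^ _); lra.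
have sd1 : sd < 1.
  rewrite /sd powRN invf_lt1 ?powR_gt0 //.
  have one : 1 `^ (r / 2) = 1 :> R by rewrite powR1.
  by rewrite -[X in X < _]one gt0_ltr_powR ?nnegrE ?divr_gt0 //; lra.
have d1 : d <= 1 by rewrite -sdd exprn_ile1 // ltW.
have Fd : F `^ (1 - r) = F * d by rewrite addE powRr1 // ltW.
have fd : 1 <= F * d.
  by rewrite -Fd -[X in X <= _](powRr0 F) ler_powR // subr_ge0.
have Fs : F * sd <= F `^ (1 - r / (2 * k%:R)).
  rewrite -[X in X * _](powRr1 (ltW F0)) -addE ler_powR // lerD2l lerN2.
  rewrite invfM mulrA ler_piMr ?divr_ge0 ?(ltW r0) // invf_le1 //.
pose phi := F `^ k%:R^-1.
have phi0 : 0 < phi by apply: powR_gt0.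
have phik : phi ^+ k = F.
  by rewrite -powR_mulrn ?powR_ge0 // -powRrM mulVf ?powRr1 ?(ltW F0) // gt_eqF.
have phid : 1 <= phi * d ^+ (2 * k).+1.
  rewrite -(powR_mulrn _ (powR_ge0 _ _)) -powRrM -addE -[X in X <= _](powRr0 F) ler_powR //.
  (* [1/k - (2k+1) rho = k rho], because [1/k = (3k+1) rho]. *)
  have -> : k%:R^-1 + - r * ((2 * k).+1)%:R = r * k%:R.
    rewrite /r /rho -[(2 * k).+1%:R]natr1 natrM; field.
    by rewrite !gt_eqF // addr_gt0 // mulr_gt0.
  by rewrite mulr_ge0 // ltW.
have F40 : 0 <= 4 * F by rewrite mulr_ge0 // ltW.
have [la la0' lak] := exists_root k0 F40.
have la0 : 0 < la.
  rewrite lt_neqAle la0' andbT; apply/eqP => la0; move: lak.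
  by rewrite -la0 expr0n gtn_eqF //= => E; lra.
have v12 : v1 != v2.
  by rewrite /v1 /v2 (inj_eq perm_inj).
have xmax v : x v <= x v1.
  by rewrite -(permKV s v) xs.
have x0' v : 0 <= x v by apply: ltW.
have lower : 4 * F - 8 <= hpoly k H x ^+ k.
  have [H' H'k low] := fan_spectral_radius R hk f2.
  apply: le_trans low _; rewrite xH.
  have H'0 : 0 <= spectral_radius R k H'.
    apply: le_trans (hpoly_le_spectral_radius H' k0 (conj x0' x1)).
    by apply: mulr_ge0 => //; apply: sumr_ge0 => e _; apply: prodr_ge0.
  have le := Hmax H' H'k.
  by rewrite ler_pXn2r ?nnegrE // (le_trans H'0).
have up := upper_estimate hk acc x0' x1 v1 v2 F2 HF d0 d1 phi0 phik phid la0 lak.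
have e2 := second_estimate hk acc x0' x1 v12 xmax F2 HF d0 d1 fd phi0 phik phid la0 lak lower.
have e1 := degree_estimate hk acc x0' x1 v12 F2 HF d0 d1 fd phi0 phik phid la0 lak lower.
have s01 : 0 < sd < 1 by rewrite sd0.
have e3 := first_estimate hk acc x0' x1 v2 xmax F2 HF d0 d1 fd phi0 phik phid la0 lak lower s01 sdd.
rewrite -/C in up e1 e2 e3; rewrite -/M2 in e3.
have y1 : `|x v1 ^+ k - k%:R^-1| <= M2 * sd.
  have -> : x v1 ^+ k - k%:R^-1 = (k%:R * x v1 ^+ k - 1) / k%:R.
    by field; rewrite gt_eqF.
  rewrite normrM [`|k%:R^-1|]ger0_norm ?invr_ge0 //.
  rewrite ler_pdivrMr //; apply: le_trans e3 _.
  by rewrite ler_peMr // mulr_ge0 // ltW.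
have weaken (m' z t : R) : m' <= M1 + M2 + C + M4 -> 0 <= t -> z <= m' * t ->
    z <= (M1 + M2 + C + M4) * t.
  by move=> mm t0 /le_trans; apply; rewrite ler_wpM2r.
split.
- apply: (weaken M1); [lra|exact: powR_ge0|].
  rewrite Fd -/F -xH ler_norml; apply/andP; split.
    have : 8 <= M1 * (F * d).
      apply: (@le_trans _ _ M1); last by rewrite ler_peMr.
      by rewrite /M1 lerDr mulr_ge0 // exprn_ge0 // addr_ge0.
    by move: lower; lra.
  have P0 : 0 <= hpoly k H x.
    by apply: mulr_ge0 => //; apply: sumr_ge0 => e _; apply: prodr_ge0.
  have : hpoly k H x ^+ k <= (la * (1 + C * d)) ^+ k.
    by rewrite ler_pXn2r ?nnegrE // (le_trans P0).
  rewrite [(la * _) ^+ k]exprMn lak.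
  have d01 : 0 <= d <= 1 by rewrite ltW.
  have := ler_wpM2l F40 (expr1D_le_linear k C0 d01).
  rewrite /M1; move: ((1 + C) ^+ k) ((1 + C * d) ^+ k) => P Q h1 h2.
  have : 0 <= F * d by lra.
  by lra.
- by apply: (weaken M2) => //; [lra|exact: ltW].
- by apply: (weaken C) => //; [lra|exact: ltW].
rewrite lerBlDr -lerBlDl; apply: (weaken M4); [lra|exact: powR_ge0|].
apply: (@le_trans _ _ (M4 * (F * sd))); last by rewrite ler_wpM2l.
set D : R := (degree H v1)%:R in e1 *.
have DF : D <= F.
  apply: le_trans HF; rewrite ler_nat; apply/subset_leq_card/subsetP => e.
  by rewrite inE => /andP[].
set a := 1 - D / F in e1.
have a0 : 0 <= a by rewrite subr_ge0 ler_pdivrMr // mul1r.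
have a1 : a <= 1 by rewrite gerBl divr_ge0 // ltW.
have -> : F - D = a * F by rewrite /a mulrBl mul1r divfK.
rewrite mulrA mulrAC ler_pM2r //.
have low : k%:R^-1 - M2 * sd <= x v1 ^+ k.
  by move: y1; rewrite ler_norml => /andP[]; lra.
have h1 : a * (k%:R^-1 - M2 * sd) <= C * d by apply: le_trans e1; rewrite ler_wpM2l.
have h2 : C * d <= C * sd.
  by rewrite ler_wpM2l // -sdd expr2 ler_piMr // ltW.
have h3 : a * (M2 * sd) <= M2 * sd by rewrite ler_piMl // mulr_ge0 // ltW.
have h4 : a * k%:R^-1 <= (C + M2) * sd by lra.
rewrite /M4 -mulrA mulrC -ler_pdivrMr //.
Qed.
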